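(* Let $f,g:\mathbb{R}^{d_x}\times\mathbb{R}^{d_y}\to\mathbb{R}$ be such that: $g(x,y)$ is $\mu$-strongly convex in $y$, has $L_g$-Lipschitz gradient, $\rho_g$-Lipschitz Hessian and $\nu_g$-Lipschitz third-order derivative; $f(x,y)$ is $C_f$-Lipschitz in $y$, has $L_f$-Lipschitz gradient and $\rho_f$-Lipschitz Hessian, and is three times continuously differentiable; and $\varphi(x)=f(x,y^*(x))$ is bounded below. Let $\ell=\max\{C_f,L_f,L_g,\rho_g,\rho_f,\nu_g\}$ and $\kappa=\ell/\mu$. Then for $\lambda\ge2L_f/\mu$ and all $x\in\mathbb{R}^{d_x}$, $\|\nabla^2\mathcal{L}^*_\lambda(x)-\nabla^2\varphi(x)\|\le D_6/\lambda$, where $$D_6:=2L_gD_2^2+\Big(1+\frac{L_g}{\mu}\Big)^2\Big(\frac{C_f\rho_f}{\mu}+\frac{C_fL_f\rho_g}{\mu^2}+\frac{C_f^2\nu_g}{2\mu^2}+\frac{C_f^2\rho_g^2}{2\mu^3}\Big)=\mathcal{O}(\ell\kappa^6),$$ with $$D_2:=\Big(\frac1\mu+\frac{2L_g}{\mu^2}\Big)\Big(L_f+\frac{C_f\rho_g}{\mu}\Big).$$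
   Context: Lipschitz continuity of derivatives is with respect to the joint variable $(x,y)$, and $\|\cdot\|$ is the operator norm. Here $y^*(x)=\arg\min_{y}g(x,y)$, $g^*(x)=g(x,y^*(x))$, $\mathcal{L}_\lambda(x,y)=f(x,y)+\lambda(g(x,y)-g^*(x))$, $y^*_\lambda(x)=\arg\min_y\mathcal{L}_\lambda(x,y)$ and $\mathcal{L}^*_\lambda(x)=\mathcal{L}_\lambda(x,y^*_\lambda(x))$; for $\lambda\ge2L_f/\mu$, $\mathcal{L}_\lambda(x,\cdot)$ is strongly convex so $y^*_\lambda$ is well defined. $\mathcal{O}(\cdot)$ hides an absolute constant. *)

(* Defs.v *)
From HB Require Import structures.
From mathcomp Require Import all_boot all_order all_algebra.
From mathcomp Require Import all_classical all_reals all_analysis.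

Set Implicit Arguments.
Unset Strict Implicit.
Unset Printing Implicit Defensive.

Import Order.TTheory GRing.Theory Num.Theory.
Import numFieldNormedType.Exports.

Local Open Scope classical_set_scope.
Local Open Scope ring_scope.

(* The norm carried by the library on 'rV[R]_n is the sup norm.  It is only used
   here for its topology (differentiability, continuity); all quantitative
   bounds use the Euclidean norm and the operator norms it induces. *)
Definition enorm (R : realType) (n : nat) (v : 'rV[R]_n) : R :=
  Num.sqrt (\sum_i v 0 i ^+ 2).

Definition opnorm (R : realType) (m n : nat) (A : 'M[R]_(m, n)) : R :=
  sup [set enorm (v *m A) | v in [set v : 'rV[R]_m | enorm v <= 1]].

(* T is the trilinear form (u, v, w) |-> \sum_(i, j, k) T k i j u_i v_j w_k. *)
Definition opnorm3 (R : realType) (n : nat) (T : 'I_n -> 'M[R]_n) : R :=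
  sup [set r | exists u v w : 'rV[R]_n,
    [/\ enorm u <= 1, enorm v <= 1, enorm w <= 1 &
        r = `|\sum_i \sum_j \sum_k T k i j * u 0 i * v 0 j * w 0 k| ] ].

Section Derivatives.
Context (R : realType) (n : nat).
Implicit Types h : 'rV[R]_n -> R.

Definition gradient h (p : 'rV[R]_n) : 'rV[R]_n :=
  \row_i 'D_(delta_mx 0 i) h p.

Definition hessian h (p : 'rV[R]_n) : 'M[R]_n := jacobian (gradient h) p.

Definition third_derivative h (p : 'rV[R]_n) : 'I_n -> 'M[R]_n :=
  fun k => 'D_(delta_mx 0 k) (hessian h) p.

Definition twice_differentiable h : Prop :=
  (forall p, differentiable h p) /\ (forall p, differentiable (gradient h) p).

Definition thrice_differentiable h : Prop :=
  twice_differentiable h /\ (forall p, differentiable (hessian h) p).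

Definition C3 h : Prop :=
  thrice_differentiable h /\
  (forall k, continuous (fun p => third_derivative h p k)).

Definition lipschitz_gradient (L : R) h : Prop :=
  forall p q, enorm (gradient h p - gradient h q) <= L * enorm (p - q).

Definition lipschitz_hessian (rho : R) h : Prop :=
  forall p q, opnorm (hessian h p - hessian h q) <= rho * enorm (p - q).

Definition lipschitz_third_derivative (nu : R) h : Prop :=
  forall p q,
    opnorm3 (fun k => third_derivative h p k - third_derivative h q k)
    <= nu * enorm (p - q).

Definition lipschitz_const (C : R) h : Prop :=
  forall p q, `|h p - h q| <= C * enorm (p - q).

Definition strongly_convex (mu : R) h : Prop :=
  0 < mu /\
  forall (p q : 'rV[R]_n) (t : R), 0 <= t <= 1 ->
    h (t *: p + (1 - t) *: q) <=
      t * h p + (1 - t) * h q - mu / 2 * t * (1 - t) * enorm (p - q) ^+ 2.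

(* A global minimizer of h; the value is 0 if h has none. *)
Definition argmin h : 'rV[R]_n := xget 0 [set y | forall y', h y <= h y'].

End Derivatives.

Section Bilevel.
Context (R : realType) (dx dy : nat).
Implicit Types f g h : 'rV[R]_dx -> 'rV[R]_dy -> R.

(* h as a function of the single joint variable z = (x, y). *)
Definition joint h : 'rV[R]_(dx + dy) -> R := fun z => h (lsubmx z) (rsubmx z).

Definition ystar h (x : 'rV[R]_dx) : 'rV[R]_dy := argmin (h x).

Definition phi f g (x : 'rV[R]_dx) : R := f x (ystar g x).

Definition gstar g (x : 'rV[R]_dx) : R := g x (ystar g x).

Definition lagrangian f g (lambda : R) (x : 'rV[R]_dx) (y : 'rV[R]_dy) : R :=
  f x y + lambda * (g x y - gstar g x).

Definition lagrangian_star f g (lambda : R) (x : 'rV[R]_dx) : R :=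
  lagrangian f g lambda x (ystar (lagrangian f g lambda) x).

End Bilevel.

(* Main.v *)
(* Let y(x) minimize g(x, .) and y_l(x) minimize k(x, .) for k = f + lambda * g;
   put z0 = (x, y(x)), z1 = (x, y_l(x)), and let P, P1 be the derivatives of
   z0, z1 in x.  Write G, H, T for the gradient, Hessian and third derivative of
   g, and F, K for the gradient and Hessian of f.

   The second block of G(z0) vanishes identically in x, and so does that of
   F(z0) + zeta(x) H(z0) for the multiplier zeta = (0, - F_y H_yy^-1).  Hence
   grad phi(x) is the first block of F(z0) + zeta(x) H(z0), and, since the second
   rows of H(z0) annihilate P, the variation of zeta contributes only at second
   order:
     hess phi = P (K(z0) + T(z0)[zeta]) P^T.
   The envelope theorem applied to k and to g gives
     hess L* = P1 (K + lambda H)(z1) P^T - lambda P H(z0) P^T,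
   where the last factor may be P^T because the y-columns of the products on its
   left vanish.  With N = K(z1) + lambda (H(z1) - H(z0)) and P1 = P + (0, D), the
   difference of the two Hessians is
     P (N - K(z0) - T(z0)[zeta]) P^T + (0, D) N P^T.
   The first term is estimated by Taylor expansion, because
   |z1 - z0| <= C_f / (lambda mu) and lambda (z1 - z0) is O(1 / lambda)-close to
   zeta; in the second one D = O(|N| / lambda). *)
Require Import Defs.
From HB Require Import structures.
From mathcomp Require Import all_boot all_order all_algebra.
From mathcomp Require Import all_classical all_reals all_analysis.
From mathcomp Require Import ring lra.

Set Implicit Arguments.
Unset Strict Implicit.
Unset Printing Implicit Defensive.

Import Order.TTheory GRing.Theory Num.Theory.
Import numFieldNormedType.Exports.

Local Open Scope classical_set_scope.
Local Open Scope ring_scope.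

(** * Euclidean and operator norms *)

Section Euclidean.
Context (R : realType).

Definition dot (n : nat) (u v : 'rV[R]_n) : R := (u *m v^T) 0 0.

Lemma dotE n (u v : 'rV[R]_n) : dot u v = \sum_i u 0 i * v 0 i.
Proof. by rewrite /dot mxE; apply: eq_bigr => i _; rewrite mxE. Qed.

Lemma dotC n (u v : 'rV[R]_n) : dot u v = dot v u.
Proof. by rewrite !dotE; apply: eq_bigr => i _; rewrite mulrC. Qed.

Lemma dotDl n (u v w : 'rV[R]_n) : dot (u + v) w = dot u w + dot v w.
Proof. by rewrite /dot mulmxDl mxE. Qed.

Lemma dotNl n (u w : 'rV[R]_n) : dot (- u) w = - dot u w.
Proof. by rewrite /dot mulNmx mxE. Qed.

Lemma dotBl n (u v w : 'rV[R]_n) : dot (u - v) w = dot u w - dot v w.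
Proof. by rewrite dotDl dotNl. Qed.

Lemma dotZl n a (u w : 'rV[R]_n) : dot (a *: u) w = a * dot u w.
Proof. by rewrite /dot -scalemxAl mxE. Qed.

Lemma dot0l n (w : 'rV[R]_n) : dot 0 w = 0.
Proof. by rewrite /dot mul0mx mxE. Qed.

Lemma dotDr n (u v w : 'rV[R]_n) : dot w (u + v) = dot w u + dot w v.
Proof. by rewrite !(dotC w) dotDl. Qed.

Lemma dotNr n (u w : 'rV[R]_n) : dot w (- u) = - dot w u.
Proof. by rewrite !(dotC w) dotNl. Qed.

Lemma dotBr n (u v w : 'rV[R]_n) : dot w (u - v) = dot w u - dot w v.
Proof. by rewrite !(dotC w) dotBl. Qed.

Lemma dotZr n a (u w : 'rV[R]_n) : dot w (a *: u) = a * dot w u.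
Proof. by rewrite !(dotC w) dotZl. Qed.

Lemma dot0r n (w : 'rV[R]_n) : dot w 0 = 0.
Proof. by rewrite dotC dot0l. Qed.

Lemma dot_mulmx m n (u : 'rV[R]_m) (A : 'M[R]_(m, n)) v :
  dot (u *m A) v = dot u (v *m A^T).
Proof. by rewrite /dot trmx_mul trmxK mulmxA. Qed.

Lemma dot_row_mx m n (a c : 'rV[R]_m) (b d : 'rV[R]_n) :
  dot (row_mx a b) (row_mx c d) = dot a c + dot b d.
Proof. by rewrite /dot tr_row_mx mul_row_col mxE. Qed.

Lemma enormE n (u : 'rV[R]_n) : enorm u = Num.sqrt (dot u u).
Proof. by rewrite dotE /enorm; congr Num.sqrt; apply: eq_bigr. Qed.

Lemma dot_ge0 n (u : 'rV[R]_n) : 0 <= dot u u.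
Proof. by rewrite dotE; apply: sumr_ge0 => i _; rewrite -expr2 sqr_ge0. Qed.

Lemma enorm_ge0 n (u : 'rV[R]_n) : 0 <= enorm u.
Proof. by rewrite enormE sqrtr_ge0. Qed.

Lemma sqr_enorm n (u : 'rV[R]_n) : enorm u ^+ 2 = dot u u.
Proof. by rewrite enormE sqr_sqrtr ?dot_ge0. Qed.

Lemma enorm0 n : enorm (0 : 'rV[R]_n) = 0.
Proof. by rewrite enormE dot0l sqrtr0. Qed.

Lemma enorm_eq0 n (u : 'rV[R]_n) : enorm u = 0 -> u = 0.
Proof.
move=> u0; have := sqr_enorm u; rewrite u0 expr0n /= dotE => /esym/eqP.
rewrite psumr_eq0; last by move=> i _; rewrite -expr2 sqr_ge0.
move=> /allP ui; apply/rowP => i; rewrite mxE.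
by have := ui i (mem_index_enum i); rewrite mulf_eq0 orbb => /eqP.
Qed.

Lemma enorm_gt0 n (u : 'rV[R]_n) : u != 0 -> 0 < enorm u.
Proof.
move=> u0; rewrite lt_neqAle enorm_ge0 andbT eq_sym.
by apply: contra u0 => /eqP/enorm_eq0 ->.
Qed.

Lemma enormZ n a (u : 'rV[R]_n) : enorm (a *: u) = `|a| * enorm u.
Proof.
by rewrite !enormE dotZl dotZr mulrA -expr2 sqrtrM ?sqr_ge0 // sqrtr_sqr.
Qed.

Lemma enormN n (u : 'rV[R]_n) : enorm (- u) = enorm u.
Proof. by rewrite -scaleN1r enormZ normrN1 mul1r. Qed.

Lemma enorm_distC n (u v : 'rV[R]_n) : enorm (u - v) = enorm (v - u).
Proof. by rewrite -enormN opprB. Qed.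

(** Cauchy-Schwarz: the squared norm of [enorm v *: u - (s * enorm u) *: v] is expanded for both
    signs [s]. *)
Lemma dot_norm_le n (u v : 'rV[R]_n) : `|dot u v| <= enorm u * enorm v.
Proof.
have [->|u0] := eqVneq u 0; first by rewrite dot0l enorm0 mul0r normr0.
have [->|v0] := eqVneq v 0; first by rewrite dot0r enorm0 mulr0 normr0.
have pu := enorm_gt0 u0; have pv := enorm_gt0 v0.
have H (s : R) : s ^+ 2 = 1 -> s * dot u v <= enorm u * enorm v.
  move=> s2; have := dot_ge0 (enorm v *: u - (s * enorm u) *: v).
  rewrite !(dotBl, dotBr, dotZl, dotZr) -!sqr_enorm (dotC v u).
  set a := enorm u in pu *; set b := enorm v in pv *; set d := dot u v => H.
  have {}H : 0 <= 2 * (a * b) * (a * b - s * d).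
    move: H; rewrite (_ : _ - _ = b ^+ 2 * a ^+ 2 - 2 * (a * b) * (s * d) +
      s ^+ 2 * (a ^+ 2 * b ^+ 2)); last by ring.
    by rewrite s2; congr (_ <= _); ring.
  by move: H; rewrite pmulr_rge0 ?subr_ge0 // mulr_gt0 // mulr_gt0.
rewrite ler_norml lerNl -mulN1r -[X in _ && (X <= _)]mul1r.
by rewrite !H // ?expr1n // sqrrN expr1n.
Qed.

Lemma dot_le n (u v : 'rV[R]_n) : dot u v <= enorm u * enorm v.
Proof. exact: le_trans (ler_norm _) (dot_norm_le _ _). Qed.

Lemma enormD n (u v : 'rV[R]_n) : enorm (u + v) <= enorm u + enorm v.
Proof.
rewrite -(@ler_pXn2r _ 2) ?nnegrE ?addr_ge0 ?enorm_ge0 //.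
rewrite sqr_enorm sqrrD !sqr_enorm !(dotDl, dotDr) (dotC v u) mulr2n.
by have := dot_le u v; lra.
Qed.

Lemma enorm_row_mx0l m n (v : 'rV[R]_n) : enorm (row_mx (0 : 'rV_m) v) = enorm v.
Proof. by rewrite !enormE dot_row_mx dot0l add0r. Qed.

Lemma enorm_row_mx0r m n (v : 'rV[R]_m) : enorm (row_mx v (0 : 'rV_n)) = enorm v.
Proof. by rewrite !enormE dot_row_mx dot0l addr0. Qed.

Lemma enorm_row_mx m n (u : 'rV[R]_m) (v : 'rV[R]_n) :
  enorm (row_mx u v) <= enorm u + enorm v.
Proof.
have -> : row_mx u v = row_mx u 0 + row_mx 0 v by rewrite add_row_mx addr0 add0r.
by apply: le_trans (enormD _ _) _; rewrite enorm_row_mx0l enorm_row_mx0r.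
Qed.

Lemma enorm_rsubmx m n (u : 'rV[R]_(m + n)) : enorm (rsubmx u) <= enorm u.
Proof.
rewrite -{2}(hsubmxK u) !enormE dot_row_mx ler_sqrt ?addr_ge0 ?dot_ge0 //.
by rewrite lerDr dot_ge0.
Qed.

Lemma enorm_le_dot n (u : 'rV[R]_n) c :
  0 <= c -> (forall v, dot u v <= c * enorm v) -> enorm u <= c.
Proof.
move=> c0 /(_ u); rewrite -sqr_enorm expr2.
have [->|u0] := eqVneq u 0; first by rewrite enorm0.
by rewrite ler_pM2r ?enorm_gt0.
Qed.

Lemma mx_norm_le_enorm n (u : 'rV[R]_n) : `|u| <= enorm u.
Proof.
rewrite /Num.norm /= mx_normrE; apply: bigmax_le; first exact: enorm_ge0.
move=> [i j] _ /=; rewrite ord1 enormE -sqrtr_sqr ler_sqrt ?dot_ge0 // dotE.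
rewrite (bigD1 j) //= -expr2 lerDl sumr_ge0 // => k _.
by rewrite -expr2 sqr_ge0.
Qed.

Lemma mx_entry_le m n (A : 'M[R]_(m, n)) i j : `|A i j| <= `|A|.
Proof.
rewrite {2}/Num.norm /= mx_normrE.
by apply/bigmax_geP; right; exists (i, j).
Qed.

Lemma entry_le_enorm n (u : 'rV[R]_n) i : `|u 0 i| <= enorm u.
Proof. exact: le_trans (mx_entry_le _ _ _) (mx_norm_le_enorm _). Qed.

Lemma enorm_le_sum n (u : 'rV[R]_n) : enorm u <= \sum_i `|u 0 i|.
Proof.
rewrite -(@ler_pXn2r _ 2) ?nnegrE ?enorm_ge0 ?sumr_ge0 //.
rewrite sqr_enorm dotE expr2 mulr_suml; apply: ler_sum => i _.
apply: le_trans (ler_norm _) _; rewrite normrM ler_wpM2l //.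
by rewrite (bigD1 i) //= lerDl sumr_ge0.
Qed.

Lemma enorm_le_mx_norm n (u : 'rV[R]_n) : enorm u <= n%:R * `|u|.
Proof.
apply: le_trans (enorm_le_sum u) _.
rewrite mulr_natl -[n in _ *+ n]card_ord -sumr_const; apply: ler_sum => i _.
exact: mx_entry_le.
Qed.

(** A crude entrywise bound; it serves only to show that suprema are finite and that linear maps are
    continuous. *)
Lemma enorm_mulmx_le m n (u : 'rV[R]_m) (A : 'M[R]_(m, n)) :
  enorm (u *m A) <= (n%:R * m%:R * `|A|) * enorm u.
Proof.
apply: le_trans (enorm_le_sum _) _.
have -> : n%:R * m%:R * `|A| * enorm u = \sum_(i < n) \sum_(j < m) (enorm u * `|A|).
  by rewrite !sumr_const !card_ord -mulrnA -[in RHS]mulr_natl natrM; ring.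
apply: ler_sum => i _; rewrite mxE; apply: le_trans (ler_norm_sum _ _ _) _.
apply: ler_sum => j _; rewrite normrM.
by apply: ler_pM => //; [exact: entry_le_enorm | exact: mx_entry_le].
Qed.

(** Finiteness must be known before [sup] can be used, since on an unbounded set [sup] is a default
    value. *)
Lemma opnorm_ubound m n (A : 'M[R]_(m, n)) :
  has_ubound [set enorm (v *m A) | v in [set v : 'rV[R]_m | enorm v <= 1]].
Proof.
exists (n%:R * m%:R * `|A|) => _ [v /= v1 <-].
apply: le_trans (enorm_mulmx_le _ _) _.
by rewrite -[leRHS]mulr1 ler_wpM2l // mulr_ge0 // mulr_ge0.
Qed.

(** An inequality, so that the zero vector is included. *)
Lemma enorm_normalize n (u : 'rV[R]_n) : enorm ((enorm u)^-1 *: u) <= 1.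
Proof.
have [->|u0] := eqVneq u 0; first by rewrite scaler0 enorm0.
by rewrite enormZ ger0_norm ?invr_ge0 ?enorm_ge0 // mulVf // gt_eqF ?enorm_gt0.
Qed.

Lemma normalizeK n (u : 'rV[R]_n) : enorm u *: ((enorm u)^-1 *: u) = u.
Proof.
have [->|u0] := eqVneq u 0; first by rewrite !scaler0.
by rewrite scalerA divff ?scale1r // gt_eqF ?enorm_gt0.
Qed.

Lemma enorm_mulmx_opnorm m n (u : 'rV[R]_m) (A : 'M[R]_(m, n)) c :
  opnorm A <= c -> enorm (u *m A) <= c * enorm u.
Proof.
move=> Ac; rewrite -{1}(normalizeK u) -scalemxAl enormZ ger0_norm ?enorm_ge0 //.
rewrite mulrC ler_wpM2r ?enorm_ge0 //; apply: le_trans Ac.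
apply: ub_le_sup; first exact: opnorm_ubound.
by exists ((enorm u)^-1 *: u) => //=; exact: enorm_normalize.
Qed.

(** The Hessian estimates are carried out on bilinear forms; this turns the last of them into an
    operator norm. *)
Lemma opnorm_le_dot m n (A : 'M[R]_(m, n)) c : 0 <= c ->
  (forall u v, dot (u *m A) v <= c * enorm u * enorm v) -> opnorm A <= c.
Proof.
move=> c0 H; apply: ge_sup; first by exists (enorm (0 *m A)), 0; rewrite //= enorm0.
move=> _ [v /= v1 <-]; apply: enorm_le_dot => // w.
apply: le_trans (H _ _) _; rewrite ler_wpM2r ?enorm_ge0 //.
by rewrite -[leRHS]mulr1 ler_wpM2l.
Qed.

Definition trilin n (T : 'I_n -> 'M[R]_n) (u v w : 'rV[R]_n) : R :=
  \sum_i \sum_j \sum_k T k i j * u 0 i * v 0 j * w 0 k.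

Lemma trilinZ n (T : 'I_n -> 'M[R]_n) a b c u v w :
  trilin T (a *: u) (b *: v) (c *: w) = a * b * c * trilin T u v w.
Proof.
rewrite /trilin mulr_sumr; apply: eq_bigr => i _.
rewrite mulr_sumr; apply: eq_bigr => j _.
rewrite mulr_sumr; apply: eq_bigr => k _; rewrite !mxE; ring.
Qed.

(** By homogeneity the vectors may be taken in the unit ball, where the sum of the absolute values
    of all entries bounds the set under the supremum. *)
Lemma trilin_opnorm3 n (T : 'I_n -> 'M[R]_n) c u v w : opnorm3 T <= c ->
  `|trilin T u v w| <= c * enorm u * enorm v * enorm w.
Proof.
move=> Tc; rewrite -{1}(normalizeK u) -{1}(normalizeK v) -{1}(normalizeK w).
rewrite trilinZ normrM ger0_norm ?mulr_ge0 ?enorm_ge0 //.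
rewrite mulrC -!mulrA ler_wpM2r ?mulr_ge0 ?enorm_ge0 //.
apply: le_trans Tc; apply: ub_le_sup; last first.
  by do 3!eexists; split; last reflexivity; exact: enorm_normalize.
exists (\sum_i \sum_j \sum_k `|T k i j|) => _ [a [b [d [a1 b1 d1 ->]]]].
apply: le_trans (ler_norm_sum _ _ _) _; apply: ler_sum => i _.
apply: le_trans (ler_norm_sum _ _ _) _; apply: ler_sum => j _.
apply: le_trans (ler_norm_sum _ _ _) _; apply: ler_sum => k _.
have e1 n' (x : 'rV[R]_n') l : enorm x <= 1 -> `|x 0 l| <= 1.
  by apply: le_trans; exact: entry_le_enorm.
rewrite !normrM -[leRHS]mulr1; apply: ler_pM; rewrite ?mulr_ge0 ?e1 //.
rewrite -[leRHS]mulr1; apply: ler_pM; rewrite ?mulr_ge0 ?e1 //.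
by rewrite -[leRHS]mulr1; apply: ler_pM; rewrite ?mulr_ge0 ?e1.
Qed.

End Euclidean.

(** * Differential calculus with respect to the Euclidean norm *)

Section Calculus.
Context (R : realType).

Lemma bounded_linear_cont (V W : normedModType R) (f : {linear V -> W}) (C : R) :
  (forall v, `|f v| <= C * `|v|) -> continuous f.
Proof.
move=> fC; apply/bounded_linear_continuous/linear_boundedP.
exists C; split; first exact: num_real.
by move=> y Cy v; apply: le_trans (fC v) _; rewrite ler_wpM2r // ltW.
Qed.

(** The epsilon form of a differential. [D] is a bare function, so its linear structure is packed
    before [diff_unique] identifies it with the differential. *)
Lemma littleo_is_diff (V W : normedModType R) (f D : V -> W) (C : R) p :
  linear D -> (forall v, `|D v| <= C * `|v|) ->
  (forall e, 0 < e -> \forall v \near (0 : V),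
    `|f (v + p) - f p - D v| <= e * `|v|) -> is_diff p f D.
Proof.
move=> lD DC H.
pose DM := GRing.isLinear.Build _ _ _ _ _ lD.
pose DL : {linear V -> W} := HB.pack D DM.
have cD : continuous DL by exact: (@bounded_linear_cont V W DL C).
have E : f \o shift p = cst (f p) + DL +o_ 0 id.
  apply/eqaddoP => e e0; apply: filterS (H e e0) => v /=.
  by rewrite !fctE /= opprD addrA.
have E2 := diff_unique cD E.
apply: DiffDef; last by rewrite E2.
by apply/diff_locallyP; rewrite E2.
Qed.

Lemma linear_bounded_is_diff (V W : normedModType R) (f : V -> W) (C : R) x :
  linear f -> (forall v, `|f v| <= C * `|v|) -> is_diff x f f.
Proof.
move=> lf fC; apply: (littleo_is_diff lf fC) => e e0; apply: nearW => v.
have -> : f (v + x) = f v + f x by have := lf 1 v x; rewrite !scale1r.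
by rewrite addrK subrr normr0 mulr_ge0 // ltW.
Qed.

Lemma mulmxr_bounded n m (A : 'M[R]_(n, m)) (v : 'rV[R]_n) :
  `|v *m A| <= ((m%:R * n%:R * `|A|) * n%:R) * `|v|.
Proof.
apply: le_trans (mx_norm_le_enorm _) _.
apply: le_trans (enorm_mulmx_le _ _) _; rewrite -[leRHS]mulrA ler_wpM2l //.
exact: enorm_le_mx_norm.
Qed.

(** Passage from the sup-norm topology to Euclidean increments; the remainder keeps the norm of [W].
    [eps_is_diff] is the converse for vector values. *)
Lemma is_diff_eps n (W : normedModType R) (F D : 'rV[R]_n -> W) p :
  is_diff p F D -> forall e, 0 < e -> exists2 d, 0 < d &
    forall q, enorm (q - p) < d ->
      `|F q - F p - D (q - p)| <= e * enorm (q - p).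
Proof.
move=> [dF <-] e e0; have /diff_locallyP[_ /eqaddoP/(_ _ e0)] := dF.
move=> /nbhs_normP[d d0 H]; exists d => // q qd.
have /H : ball_ Num.norm 0 d (q - p).
  by rewrite /= sub0r normrN; exact: le_lt_trans (mx_norm_le_enorm _) qd.
rewrite !fctE /= subrK opprD addrA => /le_trans; apply.
by rewrite ler_pM2l // mx_norm_le_enorm.
Qed.

Lemma eps_is_diff n m (F : 'rV[R]_n -> 'rV[R]_m) p (A : 'M[R]_(n, m)) :
  (forall e, 0 < e -> exists2 d, 0 < d &
    forall q, enorm (q - p) < d ->
      enorm (F q - F p - (q - p) *m A) <= e * enorm (q - p)) ->
  is_diff p F (fun v => v *m A).
Proof.
move=> H; apply: littleo_is_diff; [|exact: mulmxr_bounded|].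
  by move=> a u v; rewrite mulmxDl scalemxAl.
move=> e e0.
(* The norms are comparable with factor [n]; adding 1 keeps the divisor positive when [n] is 0. *)
have c0 : 0 < n%:R + 1 :> R by rewrite ltr_wpDl.
have [|d d0 {}H] := H (e / (n%:R + 1)); first by rewrite divr_gt0.
apply/nbhs_normP; exists (d / (n%:R + 1)); first by rewrite /= divr_gt0.
move=> v; rewrite /= sub0r normrN => vd.
have nv : enorm v <= (n%:R + 1) * `|v|.
  by apply: le_trans (enorm_le_mx_norm _) _; rewrite ler_wpM2r // lerDl.
have := H (v + p); rewrite addrK => /(_ _) {}H.
apply: le_trans (mx_norm_le_enorm _) _; apply: le_trans (H _) _.
  by apply: le_lt_trans nv _; rewrite mulrC -ltr_pdivlMr.
rewrite -mulrA ler_pM2l //.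
by rewrite ler_pdivrMl.
Qed.

Lemma is_diff_path n (W : normedModType R) (F D : 'rV[R]_n -> W) p u (t : R) :
  is_diff (p + t *: u) F D -> is_derive t 1 (fun s : R => F (p + s *: u)) (D u).
Proof.
move=> dF.
have dp : is_diff t (fun s : R => p + s *: u) (fun s => s *: u).
  have := is_diffD (is_diff_cst p t) (is_diff_scalel t u).
  by rewrite add0r.
have dFp : is_diff t (F \o (fun s : R => p + s *: u)) (D \o (fun s => s *: u)).
  exact: is_diff_comp.
have [dc vc] := dFp.
split; first exact: diff_derivable.
by rewrite deriveE // vc /= scale1r.
Qed.

Lemma MVT_is_derive (h dh : R -> R) (a b : R) : a <= b ->
  (forall t, is_derive t (1 : R) h (dh t)) ->
  exists2 c, a <= c <= b & h b - h a = dh c * (b - a).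
Proof.
move=> ab H; have [//|c] := @MVT_segment R h dh a b ab (fun t _ => H t).
  apply: continuous_subspaceT => t.
  by apply: differentiable_continuous; apply/derivable1_diffP; apply: ex_derive.
by rewrite in_itv /= => ? ?; exists c.
Qed.

(** Mean value theorem for [h] minus its quadratic majorant: the derivative [dk] is nonpositive on
    the unit interval. It is one-sided so as to apply also to the lower bound given by strong
    monotonicity. *)
Lemma taylor_le (h dh : R -> R) (K : R) :
  (forall t, is_derive t (1 : R) h (dh t)) ->
  (forall t, 0 <= t <= 1 -> dh t - dh 0 <= K * t) ->
  h 1 - h 0 - dh 0 <= K / 2.
Proof.
move=> H HK.
pose k : R -> R := h - dh 0 *: id - (K / 2) *: (id ^+ 2).
pose dk t : R := dh t - dh 0 - K * t.
have Hk (t : R) : is_derive t (1 : R) k (dk t).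
  rewrite /k; apply: is_derive_eq.
  by rewrite /dk /GRing.scale /=; field.
have [c c01] := MVT_is_derive ler01 Hk.
have := HK c c01; rewrite /k /dk !fctE /GRing.scale /=; lra.
Qed.

Lemma taylor_norm_le (h dh : R -> R) (K : R) :
  (forall t, is_derive t (1 : R) h (dh t)) ->
  (forall t, 0 <= t <= 1 -> `|dh t - dh 0| <= K * t) ->
  `|h 1 - h 0 - dh 0| <= K / 2.
Proof.
move=> H HK; rewrite ler_norml; apply/andP; split; last first.
  by apply: (taylor_le H) => t /HK; apply: le_trans; exact: ler_norm.
have HN (t : R) : is_derive t (1 : R) (- h) (- dh t) by apply: is_deriveN.
suff : (- h) 1 - (- h) 0 - - dh 0 <= K / 2 by rewrite !fctE; lra.
apply: (taylor_le HN) => t /HK; apply: le_trans.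
by have := ler_norm (dh 0 - dh t); rewrite distrC; lra.
Qed.

(** If the derivative [c] were negative, the first-order expansion with tolerance [- c / 2] would
    put [h t] below [h 0] for small [t]. *)
Lemma is_derive_ge0 (h : R -> R) (d : R) : is_derive (0 : R) (1 : R) h d ->
  (forall t, 0 < t <= 1 -> h 0 <= h t) -> 0 <= d.
Proof.
move=> [dh <-] H; rewrite leNgt; apply/negP => d0.
set c := 'D_1 h 0 in d0.
have /derivable_nbhsP/eqaddoP/(_ (- c / 2)) := dh.
have e0 : 0 < - c / 2 by rewrite divr_gt0 // oppr_gt0.
move=> /(_ e0) /nbhs_normP[r /= r0 Hr].
pose t := Num.min 1 (r / 2).
have t0 : 0 < t by rewrite lt_min ltr01 divr_gt0.
have t1 : t <= 1 by rewrite ge_min lexx.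
have tr : t < r by rewrite gt_min; apply/orP; right; rewrite ltr_pdivrMr // ltr_pMr // ltr1n.
have := Hr t; rewrite /= sub0r normrN gtr0_norm // => /(_ tr).
rewrite !fctE /= /GRing.scale /= mulr1 addr0 -/c => /(le_trans (ler_norm _)).
have := H t; rewrite t0 t1 => /(_ isT) Ht.
have : c * t < 0 by rewrite nmulr_rlt0.
by move=> ct; rewrite opprD addrA; lra.
Qed.

(** Both [K *: id - h] and [K *: id + h] are least at 0 among the points of the unit interval. *)
Lemma is_derive_norm_le (h : R -> R) (d K : R) : is_derive (0 : R) (1 : R) h d ->
  (forall t, 0 < t <= 1 -> `|h t - h 0| <= K * t) -> `|d| <= K.
Proof.
move=> dh H.
have H1 : 0 <= K - d.
  apply: (@is_derive_ge0 (K *: id - h)).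
    by apply: is_derive_eq; rewrite /GRing.scale /= mulr1.
  move=> t /[dup] /H; rewrite ler_norml !fctE /GRing.scale /=; lra.
have H2 : 0 <= K + d.
  apply: (@is_derive_ge0 (K *: id + h)).
    by apply: is_derive_eq; rewrite /GRing.scale /= mulr1.
  move=> t /[dup] /H; rewrite ler_norml !fctE /GRing.scale /=; lra.
by rewrite ler_norml; apply/andP; split; lra.
Qed.

Lemma gradientE n (F : 'rV[R]_n -> R) p : differentiable F p ->
  is_diff p F (dot (gradient F p)).
Proof.
move=> dF; apply: DiffDef => //; apply/funext => v.
rewrite [in LHS](row_sum_delta v) linear_sum dotE; apply: eq_bigr => i _.
by rewrite linearZ /= mxE -deriveE // mulrC.
Qed.

Lemma jacobianE n m (F : 'rV[R]_n -> 'rV[R]_m) p : differentiable F p ->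
  is_diff p F (fun v => v *m jacobian F p).
Proof.
by move=> dF; apply: DiffDef => //; apply/funext => v; rewrite mul_rV_lin1.
Qed.

Lemma is_diff_gradient n (F : 'rV[R]_n -> R) p g : is_diff p F (dot g) ->
  gradient F p = g.
Proof.
move=> [dF E]; apply/rowP => i; rewrite mxE deriveE // E dotC.
by rewrite /dot -rowE !mxE.
Qed.

Lemma is_diff_jacobian n m (F : 'rV[R]_n -> 'rV[R]_m) p A :
  is_diff p F (fun v => v *m A) -> jacobian F p = A.
Proof. by move=> [dF E]; apply/matrixP => i j; rewrite mxE E -rowE mxE. Qed.

Lemma is_diff_dotl n (W : normedModType R) (F D : W -> 'rV[R]_n) p v :
  is_diff p F D -> is_diff p (fun q => dot (F q) v) (fun w => dot (D w) v).
Proof.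
move=> dF; apply: (@is_diff_comp _ _ _ _ F D (fun u => dot u v) (fun u => dot u v)) => //.
apply: (@linear_bounded_is_diff _ _ _ (n%:R * enorm v)).
  by move=> a x y; rewrite dotDl dotZl.
move=> u; have /le_trans := dot_norm_le u v; apply.
by rewrite mulrAC ler_wpM2r ?enorm_ge0 // enorm_le_mx_norm.
Qed.

Lemma is_diff_mulmxl m n (W : normedModType R) (F D : W -> 'M[R]_(m, n)) p u :
  is_diff p F D -> is_diff p (fun q => u *m F q : 'rV[R]_n) (fun w => u *m D w).
Proof.
move=> dF; apply: (@is_diff_comp _ _ _ _ F D (mulmx u) (mulmx u)) => //.
apply: (@linear_bounded_is_diff _ _ _ (n%:R * m%:R * enorm u)).
  exact: linearP.
move=> A; apply: le_trans (mx_norm_le_enorm _) _.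
by apply: le_trans (enorm_mulmx_le _ _) _; rewrite mulrAC.
Qed.

Lemma is_diff_mulmxr n m k (F D : 'rV[R]_k -> 'rV[R]_n) p (A : 'M[R]_(n, m)) :
  is_diff p F D -> is_diff p (fun q => F q *m A) (fun w => D w *m A).
Proof.
move=> dF; apply: (@is_diff_comp _ _ _ _ F D (mulmxr A) (mulmxr A)) => //.
apply: linear_bounded_is_diff (@mulmxr_bounded _ _ A) => a u v.
by rewrite mulmxDl scalemxAl.
Qed.

(** The second difference over the parallelogram with sides [t *: u] and [t *: v] is t^2 times the
    Hessian form, up to o(t^2). Differentiability of the gradient at the single point [p]
    suffices. *)
Lemma second_difference n (F : 'rV[R]_n -> R) (G : 'rV[R]_n -> 'rV[R]_n) p H u v e :
  (forall q, is_diff q F (dot (G q))) -> is_diff p G (fun w => w *m H) ->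
  0 < e -> exists2 d, 0 < d & forall t, 0 < t < d ->
  `|F (p + t *: u + t *: v) - F (p + t *: u) - F (p + t *: v) + F p
    - t ^+ 2 * dot (u *m H) v| <= e * t ^+ 2.
Proof.
move=> dF dG e0; pose B := enorm u + enorm v + 1.
have B0 : 0 < B by rewrite ltr_wpDl // addr_ge0 ?enorm_ge0.
have uB : enorm u + enorm v <= B by rewrite /B lerDl.
have vB : enorm v <= B by have := enorm_ge0 u; rewrite /B; lra.
(* Two expansions of [G] at distance at most [t * B] will be paired with [v], whose norm is at most
   [B]; this tolerance makes each cost at most [e * t / 2]. *)
have [|d d0 {}dG] := is_diff_eps dG (e := e / (2 * n.+1%:R * B ^+ 2)).
  by rewrite divr_gt0 // !mulr_gt0 // ?exprn_gt0.
exists (d / B); first by rewrite divr_gt0.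
move=> t /andP[t0 td].
(* The second difference is [h t - h 0]; after the mean value theorem in [s], both gradients in
   [dh c] are expanded at [p], and the terms in [c] cancel. *)
pose h s := F (p + t *: u + s *: v) - F (p + s *: v).
pose dh s := dot (G (p + t *: u + s *: v)) v - dot (G (p + s *: v)) v.
have Hh (s : R) : is_derive s (1 : R) h (dh s).
  by apply: is_deriveB; apply: is_diff_path.
have [c /andP[c0 ct]] := MVT_is_derive (ltW t0) Hh.
rewrite subr0 /h scale0r !addr0 opprB addrA => hE.
rewrite [X in X - _ * _](_ : _ = dh c * t); last by rewrite -hE; ring.
have est a b : 0 <= a <= t -> 0 <= b <= t ->
    `|dot (G (p + (a *: u + b *: v)) - G p - (a *: u + b *: v) *m H) v| <=
       e * t / 2.
  move=> /andP[a0 at_] /andP[b0 bt].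
  have ab : enorm (a *: u + b *: v) <= t * B.
    apply: le_trans (enormD _ _) _; rewrite !enormZ !ger0_norm //.
    apply: (@le_trans _ _ (t * (enorm u + enorm v))); last by rewrite ler_pM2l.
    by rewrite mulrDr; apply: lerD; rewrite ler_wpM2r ?enorm_ge0.
  have := dG (p + (a *: u + b *: v)); rewrite addrAC subrr add0r => /(_ _) K.
  apply: le_trans (dot_norm_le _ _) _.
  apply: (@le_trans _ _ ((n%:R * (e / (2 * n.+1%:R * B ^+ 2) * (t * B))) * B)).
    apply: ler_pM; rewrite ?enorm_ge0 //.
    apply: le_trans (enorm_le_mx_norm _) _; rewrite ler_wpM2l //.
    apply: le_trans (K _) _.
      by apply: le_lt_trans ab _; rewrite -ltr_pdivlMr.
    by rewrite ler_wpM2l // ltW // divr_gt0 // !mulr_gt0 // ?exprn_gt0.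
  have n1 : n.+1%:R != 0 :> R by rewrite pnatr_eq0.
  rewrite (_ : _ * B = (e * t / 2) * (n%:R / n.+1%:R)); last first.
    by field; rewrite nat1r n1 /= gt_eqF.
  rewrite -[leRHS]mulr1 ler_wpM2l //; first by rewrite !mulr_ge0 // ltW.
  by rewrite ler_pdivrMr // mul1r ler_nat.
have K1 := est t c; rewrite lexx c0 ct (ltW t0) in K1.
have K2 := est 0 c; rewrite lexx c0 ct (ltW t0) scale0r add0r in K2.
have {K1} := K1 isT isT; have {K2} := K2 isT isT.
rewrite !(mulmxDl, dotDl, dotNl, =^~ scalemxAl, dotZl) /dh !addrA.
set X1 := dot (G (p + c *: v)) v; set X2 := dot (G p) v.
set X3 := dot (v *m H) v; set X4 := dot (G _) v; set X5 := dot (u *m H) v.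
move=> Y1 Y2.
have -> : (X4 - X1) * t - t ^+ 2 * X5 =
  t * ((X4 - X2 - (t * X5 + c * X3)) - (X1 - X2 - c * X3)) by ring.
rewrite normrM gtr0_norm // expr2 mulrCA ler_pM2l //.
by apply: le_trans (ler_normB _ _) _; lra.
Qed.

(** The second difference is symmetric in [u] and [v], and divided by t^2 it approximates both
    sides. *)
Lemma Schwarz_symmetry n (F : 'rV[R]_n -> R) (G : 'rV[R]_n -> 'rV[R]_n) p H u v :
  (forall q, is_diff q F (dot (G q))) -> is_diff p G (fun w => w *m H) ->
  dot (u *m H) v = dot (v *m H) u.
Proof.
move=> dF dG; apply/eqP; rewrite -subr_eq0 -normr_le0.
apply/ler_addgt0Pr => e e0; rewrite add0r.
have e20 : 0 < e / 2 by rewrite divr_gt0.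
have [d1 d10 H1] := second_difference u v dF dG e20.
have [d2 d20 H2] := second_difference v u dF dG e20.
pose t := Num.min d1 d2 / 2.
have t0 : 0 < t by rewrite divr_gt0 // lt_min d10.
have tm : t < Num.min d1 d2 by rewrite ltr_pdivrMr // ltr_pMr ?ltr1n // lt_min d10.
move: tm; rewrite lt_min => /andP[td1 td2].
have := H1 t; have := H2 t; rewrite t0 td1 td2 => /(_ isT) + /(_ isT).
rewrite (addrAC p (t *: v)).
set X1 := F _; set X2 := F _; set X3 := F _; set X4 := F p.
set a := dot _ u; set b := dot _ v => Y1 Y2.
have t20 : 0 < t ^+ 2 by rewrite exprn_gt0.
rewrite -(ler_pM2l t20) -(gtr0_norm t20) -normrM (gtr0_norm t20).
have -> : t ^+ 2 * (b - a) = (X1 - X2 - X3 + X4 - t ^+ 2 * a) -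
   (X1 - X3 - X2 + X4 - t ^+ 2 * b) by ring.
by apply: le_trans (ler_normB _ _) _; lra.
Qed.

End Calculus.

(** * Hessians, third derivatives and strong monotonicity *)

Lemma trilinB_opnorm3 (R : realType) n (S T : 'I_n -> 'M[R]_n) c u v w :
  opnorm3 (fun k => S k - T k) <= c ->
  `|trilin S u v w - trilin T u v w| <= c * enorm u * enorm v * enorm w.
Proof.
have -> : trilin S u v w - trilin T u v w = trilin (fun k => S k - T k) u v w.
  rewrite /trilin -sumrB; apply: eq_bigr => i _.
  rewrite -sumrB; apply: eq_bigr => j _; rewrite -sumrB; apply: eq_bigr => k _.
  by rewrite !mxE; ring.
exact: trilin_opnorm3.
Qed.

Section HigherDerivatives.
Context (R : realType) (n : nat) (h : 'rV[R]_n -> R).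
Implicit Types p q u v w : 'rV[R]_n.

Lemma is_diff_hessian_dot p v : twice_differentiable h ->
  is_diff p (fun q => dot (gradient h q) v) (fun w => dot (w *m hessian h p) v).
Proof. by move=> [_ h2]; apply: is_diff_dotl; exact: jacobianE. Qed.

Lemma hessian_sym p u v : twice_differentiable h ->
  dot (u *m hessian h p) v = dot (v *m hessian h p) u.
Proof.
move=> [h1 h2]; apply: (@Schwarz_symmetry _ _ h (gradient h) p).
  by move=> q; exact: gradientE.
exact: jacobianE.
Qed.

Lemma hessian_path p v u (t : R) : twice_differentiable h ->
  is_derive t (1 : R) (fun s : R => dot (gradient h (p + s *: u)) v)
    (dot (u *m hessian h (p + t *: u)) v).
Proof. by move=> h2; apply: is_diff_path (is_diff_hessian_dot _ _ h2). Qed.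

Lemma hessian_norm_le L p u v : twice_differentiable h -> lipschitz_gradient L h ->
  `|dot (u *m hessian h p) v| <= L * enorm u * enorm v.
Proof.
move=> h2 hL; have := hessian_path p v u 0 h2; rewrite scale0r addr0.
move=> /is_derive_norm_le; apply => t /andP[t0 _].
rewrite scale0r addr0 -dotBl; apply: le_trans (dot_norm_le _ _) _.
rewrite mulrAC ler_wpM2r ?enorm_ge0 //; apply: le_trans (hL _ _) _.
by rewrite addrAC subrr add0r enormZ gtr0_norm // mulrCA mulrC.
Qed.

Lemma hessian_lip rho p q u v : lipschitz_hessian rho h ->
  `|dot (u *m (hessian h p - hessian h q)) v| <=
    rho * enorm (p - q) * enorm u * enorm v.
Proof.
move=> hr; apply: le_trans (dot_norm_le _ _) _.
by rewrite ler_wpM2r ?enorm_ge0 //; apply: enorm_mulmx_opnorm.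
Qed.

Fact third_spec : {D | forall p w, D p w = 'd (hessian h) p w :> 'M[R]_n}.
Proof. by exists (fun p w => 'd (hessian h) p w). Qed.

(* Sealed: unifying ['d (hessian h) p] with ['d (hessian h) q] does not
   terminate in reasonable time. *)
Definition third : 'rV[R]_n -> 'rV[R]_n -> 'M[R]_n := sval third_spec.

Lemma thirdE p w : third p w = 'd (hessian h) p w.
Proof. exact: (svalP third_spec). Qed.

Lemma third_linear p a u v : third p (a *: u + v) = a *: third p u + third p v.
Proof. by rewrite !thirdE linearP. Qed.

Lemma is_diff_third p : thrice_differentiable h -> is_diff p (hessian h) (third p).
Proof.
by move=> [_ h3]; apply: DiffDef => //; apply/funext => w; rewrite thirdE.
Qed.

Lemma third_path p u v d (t : R) : thrice_differentiable h ->
  is_derive t (1 : R) (fun s : R => dot (u *m hessian h (p + s *: d)) v)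
    (dot (u *m third (p + t *: d) d) v).
Proof.
move=> h3.
apply: (@is_diff_path _ _ _ (fun q => dot (u *m hessian h q) v)
  (fun w => dot (u *m third (p + t *: d) w) v)).
by apply: is_diff_dotl; apply: is_diff_mulmxl; exact: is_diff_third.
Qed.

Lemma third_norm_le rho p u v w : thrice_differentiable h ->
  lipschitz_hessian rho h ->
  `|dot (u *m third p w) v| <= rho * enorm w * enorm u * enorm v.
Proof.
move=> h3 hr; have := third_path p u v w 0 h3; rewrite scale0r addr0.
move=> /is_derive_norm_le; apply => t /andP[t0 _].
rewrite scale0r addr0 -dotBl -mulmxBr; apply: le_trans (hessian_lip _ _ _ _ hr) _.
by rewrite addrAC subrr add0r enormZ gtr0_norm //; lra.
Qed.

(** Links the coordinate array of [opnorm3] to the differential of the Hessian: the last argument is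
    the direction of differentiation. *)
Lemma trilin_third p u v w : thrice_differentiable h ->
  trilin (third_derivative h p) u v w = dot (u *m third p w) v.
Proof.
move=> [_ h3]; rewrite thirdE [in RHS](row_sum_delta w) linear_sum.
rewrite /trilin dotE.
under [in RHS]eq_bigr do rewrite mxE mulr_suml.
rewrite [in RHS]exchange_big /=; apply: eq_bigr => i _; apply: eq_bigr => j _.
rewrite summxE mulr_sumr mulr_suml; apply: eq_bigr => k _.
by rewrite linearZ /= mxE /third_derivative deriveE //; ring.
Qed.

Lemma third_lip nu p q u v w : thrice_differentiable h ->
  lipschitz_third_derivative nu h ->
  `|dot (u *m third p w) v - dot (u *m third q w) v| <=
    nu * enorm (p - q) * enorm u * enorm v * enorm w.
Proof.
move=> h3 hn; rewrite -(trilin_third p u v w h3) -(trilin_third q u v w h3).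
exact: (@trilinB_opnorm3 _ _ (third_derivative h p) (third_derivative h q) _ u v w (hn p q)).
Qed.

(** Exchanges the direction of differentiation with a Hessian argument: Schwarz symmetry for
    [dot (gradient h q) v], whose gradient in [q] is [v *m hessian h q]. *)
Lemma third_sym p u v w : thrice_differentiable h ->
  dot (u *m third p w) v = dot (w *m third p u) v.
Proof.
move=> h3; have [h2 _] := h3.
(* The derivative of a symmetric matrix is symmetric. *)
have symm a b c : dot (a *m third p b) c = dot (c *m third p b) a.
  have D a' c' : is_diff p (fun q => dot (a' *m hessian h q) c')
      (fun b => dot (a' *m third p b) c').
    by apply: is_diff_dotl; apply: is_diff_mulmxl; exact: is_diff_third.
  have [_ E1] := D a c; have [_ E2] := D c a.
  move: E1 E2; rewrite (_ : (fun q => dot (a *m hessian h q) c) =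
    (fun q => dot (c *m hessian h q) a)); last by apply/funext => q; exact: hessian_sym.
  by move=> -> /(congr1 (@^~ b)).
pose G q := v *m hessian h q.
have DG : is_diff p G (fun b => v *m third p b).
  by apply: is_diff_mulmxl; exact: is_diff_third.
have GE b : b *m jacobian G p = v *m third p b.
  have [dG E1] := DG; have [_ E2] := jacobianE dG.
  by rewrite -[RHS](congr1 (@^~ b) E1) E2.
rewrite symm (symm w) -!GE; apply: (@Schwarz_symmetry _ _ (fun q => dot (gradient h q) v) G p).
  move=> q; rewrite (_ : dot (G q) = (fun w => dot (w *m hessian h q) v)).
    exact: is_diff_hessian_dot.
  by apply/funext => b; exact: hessian_sym.
by apply: jacobianE; have [] := DG.
Qed.

Lemma gradient_taylor rho p q v : twice_differentiable h -> lipschitz_hessian rho h ->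
  `|dot (gradient h q - gradient h p - (q - p) *m hessian h p) v| <=
    rho / 2 * enorm (q - p) ^+ 2 * enorm v.
Proof.
move=> h2 hr; set d := q - p.
have := taylor_norm_le (fun t => hessian_path p v d t h2)
  (K := rho * enorm d ^+ 2 * enorm v).
rewrite scale0r scale1r addr0 {1}/d addrCA subrr addr0 -!dotBl => H.
apply: le_trans (H _) _; last by lra.
move=> t /andP[t0 _]; rewrite -dotBl -mulmxBr; apply: le_trans (hessian_lip _ _ _ _ hr) _.
by rewrite addrAC subrr add0r enormZ ger0_norm // expr2; lra.
Qed.

Lemma hessian_taylor nu p q u v : thrice_differentiable h ->
  lipschitz_third_derivative nu h ->
  `|dot (u *m (hessian h q - hessian h p - third p (q - p))) v| <=
    nu / 2 * enorm (q - p) ^+ 2 * enorm u * enorm v.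
Proof.
move=> h3 hn; set d := q - p.
have A (t : R) : 0 <= t -> nu * enorm (p + t *: d - p) * enorm u * enorm v * enorm d
    <= nu * enorm d ^+ 2 * enorm u * enorm v * t.
  by move=> t0; rewrite addrAC subrr add0r enormZ ger0_norm // expr2; lra.
have B : nu * enorm d ^+ 2 * enorm u * enorm v / 2
    = nu / 2 * enorm d ^+ 2 * enorm u * enorm v by field.
pose f s := dot (u *m hessian h (p + s *: d)) v.
pose df s := dot (u *m third (p + s *: d) d) v.
have e0 : p + 0 *: d = p by rewrite scale0r addr0.
have e1 : p + 1 *: d = q by rewrite scale1r /d addrC subrK.
have f0 : f 0 = dot (u *m hessian h p) v by congr (dot (u *m hessian h _) v).
have f1 : f 1 = dot (u *m hessian h q) v by congr (dot (u *m hessian h _) v).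
have df0 : df 0 = dot (u *m third p d) v by congr (dot (u *m third _ d) v).
have H (t : R) : 0 <= t <= 1 ->
    `|df t - df 0| <= (nu * enorm d ^+ 2 * enorm u * enorm v) * t.
  move=> /andP[t0 _]; rewrite df0 /df; apply: le_trans (third_lip _ _ _ _ _ h3 hn) _.
  exact: A.
have -> : dot (u *m (hessian h q - hessian h p - third p d)) v = f 1 - f 0 - df 0.
  by rewrite f1 f0 df0 2!mulmxBr 2!dotBl.
have /le_trans := @taylor_norm_le R f df _ (fun t => third_path p u v d t h3) H; apply.
by rewrite B.
Qed.

End HigherDerivatives.

(** * Strong convexity, monotone gradients and existence of minimizers *)

Section StrongMonotonicity.
Context (R : realType) (n : nat) (k : 'rV[R]_n -> R) (m : R).
Hypothesis dk : forall p, differentiable k p.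
Implicit Types p q u v w : 'rV[R]_n.

Let path p u (t : R) :
  is_derive t (1 : R) (fun s : R => k (p + s *: u)) (dot (gradient k (p + t *: u)) u).
Proof. by apply: is_diff_path; exact: gradientE. Qed.

Lemma strongly_convex_first_order p q : strongly_convex m k ->
  dot (gradient k q) (p - q) + m / 2 * enorm (p - q) ^+ 2 <= k p - k q.
Proof.
move=> [m0 kc]; set N := enorm (p - q); have := path q (p - q) 0.
rewrite scale0r addr0; set D := dot _ _ => Dk; rewrite -subr_ge0.
pose g (s : R) := k (q + s *: (p - q)).
have Dg : is_derive (0 : R) (1 : R) g D by [].
have g0 : g 0 = k q by rewrite /g scale0r addr0.
(* Up to the constant [k q], this function is the slack in the strong convexity inequality, which
   vanishes at 0 and is nonnegative on the unit interval. *)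
apply: (@is_derive_ge0 _ ((k p - k q - m / 2 * N ^+ 2) *: id
   + (m / 2 * N ^+ 2) *: (id ^+ 2) - g)).
  by apply: is_derive_eq; rewrite /GRing.scale /=; ring.
move=> t /andP[t0 t1]; have := kc p q t; rewrite (ltW t0) t1 => /(_ isT).
have -> : t *: p + (1 - t) *: q = q + t *: (p - q).
  by rewrite scalerBr scalerBl scale1r addrCA.
rewrite -/(g t) !fctE g0 /GRing.scale /= -/N; lra.
Qed.

Lemma strongly_convex_monotone p q : strongly_convex m k ->
  m * enorm (p - q) ^+ 2 <= dot (gradient k p - gradient k q) (p - q).
Proof.
move=> kc; have := strongly_convex_first_order p q kc.
have := strongly_convex_first_order q p kc.
by rewrite (enorm_distC q) -(opprB p q) dotNr dotBl; lra.
Qed.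

Hypothesis m0 : 0 < m.
Hypothesis km : forall p q,
  m * enorm (p - q) ^+ 2 <= dot (gradient k p - gradient k q) (p - q).

(** From here on the assumption is monotonicity of the gradient, the form in which the penalized
    function inherits convexity from [g]. The bound is [taylor_le] for [- k] on the segment from [q]
    to [p]. *)
Lemma monotone_quadratic_growth p q :
  dot (gradient k q) (p - q) + m / 2 * enorm (p - q) ^+ 2 <= k p - k q.
Proof.
set d := p - q.
have H (t : R) : is_derive t (1 : R) (- (fun s : R => k (q + s *: d)))
    (- dot (gradient k (q + t *: d)) d) by apply: is_deriveN.
have := taylor_le H (K := - (m * enorm d ^+ 2)).
rewrite !fctE scale0r scale1r addr0 addrCA subrr addr0 => /(_ _) T.
suff : - k p - - k q - - dot (gradient k q) d <= - (m * enorm d ^+ 2) / 2 by lra.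
apply: T => t /andP[t0 _]; move: t0; rewrite le_eqVlt => /orP[/eqP<-|t0].
  by rewrite scale0r addr0; lra.
have := km (q + t *: d) q; rewrite addrAC subrr add0r enormZ gtr0_norm // dotZr dotBl.
rewrite exprMn (_ : m * _ = t * (m * enorm d ^+ 2 * t)); last by ring.
by rewrite ler_pM2l //; lra.
Qed.

Lemma monotone_minimizer : exists y, forall y', k y <= k y'.
Proof.
(* Beyond this radius the quadratic growth from 0 outweighs the linear term, so [k] exceeds [k 0]; a
   minimizer over the compact ball is therefore global. *)
pose r := 2 * enorm (gradient k 0) / m.
have r0 : 0 <= r by rewrite divr_ge0 ?(ltW m0) // mulr_ge0 // enorm_ge0.
pose A : set 'rV[R]_n := [set y | `|y| <= r].
have A0 : A 0 by rewrite /A /= normr0.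
have Ac : compact A.
  apply: bounded_closed_compact.
    exists r; split; first exact: num_real.
    by move=> M rM y /= yr; apply: le_trans yr (ltW rM).
  apply: (@closed_comp _ _ (fun y : 'rV[R]_n => `|y|) [set x | x <= r]).
    by move=> y _; exact: norm_continuous.
  exact: closed_le.
have [||y yA ymin] := @EVT_min_rV R n k A _ Ac.
- by exists 0.
- by apply: continuous_subspaceT => y; exact: differentiable_continuous.
exists y => y'; have [y'A|] := leP `|y'| r; first by apply: ymin; rewrite inE.
move=> ry'; apply: (@le_trans _ _ (k 0)); first by apply: ymin; rewrite inE.
have := monotone_quadratic_growth y' 0; rewrite subr0.
have := dot_norm_le (gradient k 0) y'; rewrite ler_norml => /andP[+ _].
have : r < enorm y' by apply: lt_le_trans ry' (mx_norm_le_enorm _).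
rewrite ltr_pdivrMr // => H1 H2 H3.
have := enorm_ge0 y' => H4.
have : 0 <= enorm y' * (enorm y' * m - 2 * enorm (gradient k 0)).
  by rewrite mulr_ge0 // subr_ge0 ltW.
rewrite expr2 in H3; nra.
Qed.

(** Existence rules out the default value of [argmin]. At a minimizer the derivative along minus the
    gradient, which is minus its squared norm, is nonnegative. *)
Lemma gradient_argmin : gradient k (argmin k) = 0.
Proof.
have ymin : forall y', k (argmin k) <= k y'.
  have [y hy] := monotone_minimizer.
  exact: (@xgetPex _ 0 [set y | forall y', k y <= k y'] (ex_intro _ y hy)).
set y := argmin k in ymin *.
apply: enorm_eq0; apply/eqP; rewrite -sqrf_eq0 eq_le sqr_ge0 andbT sqr_enorm.
have := path y (- gradient k y) 0; rewrite scale0r addr0 => /is_derive_ge0.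
by rewrite dotNr oppr_ge0; apply => t _; rewrite scale0r addr0.
Qed.

End StrongMonotonicity.

(** * Implicitly defined solutions and envelope formulas *)

Lemma dot_rsubmx0 (R : realType) m n (a : 'rV[R]_(m + n)) u v :
  rsubmx a = 0 -> dot a (row_mx u v) = dot (lsubmx a) u.
Proof. by move=> a0; rewrite -{1}(hsubmxK a) dot_row_mx a0 dot0l addr0. Qed.

Lemma dot_row_mx0l (R : realType) m n (a : 'rV[R]_(m + n)) v :
  dot a (row_mx 0 v) = dot (rsubmx a) v.
Proof. by rewrite -{1}(hsubmxK a) dot_row_mx dot0r add0r. Qed.

(** Coercivity makes the kernel trivial. *)
Lemma coercive_unitmx (R : realType) n (A : 'M[R]_n) m : 0 < m ->
  (forall v, m * enorm v ^+ 2 <= dot (v *m A) v) -> A \in unitmx.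
Proof.
move=> m0 H; rewrite -row_free_unit; apply: inj_row_free => v vA.
apply: enorm_eq0; apply/eqP; rewrite -sqrf_eq0 eq_le sqr_ge0 andbT.
by have := H v; rewrite vA dot0l pmulr_rle0.
Qed.

(* y is a zero of the second block of G; in the application G is the gradient
   of the joint function and H its Hessian. *)
Section ImplicitFunction.
Context (R : realType) (dx dy : nat).
Variables (G : 'rV[R]_(dx + dy) -> 'rV[R]_(dx + dy)).
Variables (H : 'rV[R]_(dx + dy) -> 'M[R]_(dx + dy)).
Variables (y : 'rV[R]_dx -> 'rV[R]_dy) (L m : R).
Hypothesis dG : forall z, is_diff z G (fun v => v *m H z).
Hypothesis GL : forall p q, enorm (G p - G q) <= L * enorm (p - q).
Hypothesis HL : forall p u v, `|dot (u *m H p) v| <= L * enorm u * enorm v.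
Hypothesis m0 : 0 < m.
Hypothesis Gm : forall x p q, m * enorm (p - q) ^+ 2 <=
  dot (rsubmx (G (row_mx x p)) - rsubmx (G (row_mx x q))) (p - q).
Hypothesis y0 : forall x, rsubmx (G (row_mx x (y x))) = 0.

Definition graph_pt x : 'rV[R]_(dx + dy) := row_mx x (y x).
Local Notation z := graph_pt.

Lemma rsubmx_graph_pt x : rsubmx (G (z x)) = 0.
Proof. exact: y0. Qed.

(** Monotonicity is used over [x] between [y x] and [y x']. As the second block of [G] vanishes at
    both graph points, the difference of its values reduces to a change of first argument from [x']
    to [x] at fixed [y x']. *)
Lemma lipschitz_solution x x' : enorm (y x - y x') <= L / m * enorm (x - x').
Proof.
have [->|yy] := eqVneq (y x) (y x').
  rewrite subrr enorm0 mulrAC divr_ge0 ?(ltW m0) //.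
  (* The sign of [L] is not among the assumptions here; the Lipschitz bound itself shows that the
     right-hand side is nonnegative. *)
  have := GL (row_mx x 0) (row_mx x' 0).
  rewrite opp_row_mx add_row_mx subrr enorm_row_mx0r; apply: le_trans.
  exact: enorm_ge0.
have d0 : 0 < enorm (y x - y x') by rewrite enorm_gt0 // subr_eq0.
rewrite mulrAC ler_pdivlMr // mulrC -(ler_pM2r d0).
have := Gm x (y x) (y x'); rewrite y0 -(y0 x') expr2 mulrA => /le_trans; apply.
apply: le_trans (dot_le _ _) _; rewrite ler_pM2r //.
rewrite -linearB /=; apply: le_trans (enorm_rsubmx _) _.
apply: le_trans (GL _ _) _.
by rewrite opp_row_mx add_row_mx subrr enorm_row_mx0r enorm_distC.
Qed.

Lemma enorm_graph_pt_le x x' : enorm (z x - z x') <= (1 + L / m) * enorm (x - x').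
Proof.
rewrite opp_row_mx add_row_mx; apply: le_trans (enorm_row_mx _ _) _.
by rewrite mulrDl mul1r lerD2l; exact: lipschitz_solution.
Qed.

(** The monotonicity inequality along [row_mx 0 v], differentiated at the base point. *)
Lemma hessian_coercive x p v :
  m * enorm v ^+ 2 <= dot (row_mx 0 v *m H (row_mx x p)) (row_mx 0 v).
Proof.
set w : 'rV[R]_(dx + dy) := row_mx 0 v.
have := @is_diff_path R _ _ (fun q => dot (G q) w)
  (fun b => dot (b *m H (row_mx x p)) w) (row_mx x p) w 0.
rewrite scale0r addr0 => /(_ (is_diff_dotl _ (dG _))) D.
pose g (s : R) := dot (G (row_mx x p + s *: w)) w.
have Dg : is_derive (0 : R) (1 : R) g (dot (w *m H (row_mx x p)) w) by [].
rewrite -subr_ge0; apply: (@is_derive_ge0 _ (g - (m * enorm v ^+ 2) *: id)).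
  by apply: is_derive_eq; rewrite /GRing.scale /= mulr1.
move=> t /andP[t0 _]; rewrite !fctE /GRing.scale /= mulr0 subr0.
suff : m * enorm v ^+ 2 * t <= g t - g 0 by lra.
rewrite -(ler_pM2l t0) /g scale0r addr0.
have := Gm x (p + t *: v) p; rewrite addrAC subrr add0r enormZ gtr0_norm // dotZr.
rewrite dotBl /w !dot_row_mx0l scale_row_mx scaler0 add_row_mx addr0.
by rewrite exprMn; lra.
Qed.

(** The implicit function formula - H_xy H_yy^-1, in the row-vector convention. *)
Definition solution_deriv x : 'M[R]_(dx, dy) :=
  - ursubmx (H (z x)) *m invmx (drsubmx (H (z x))).

Definition graph_deriv x : 'M[R]_(dx, dx + dy) := row_mx 1%:M (solution_deriv x).
Local Notation P := graph_deriv.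

Lemma drsubmx_coercive x p v :
  m * enorm v ^+ 2 <= dot (v *m drsubmx (H (row_mx x p))) v.
Proof.
apply: le_trans (hessian_coercive x p v) _.
rewrite dot_row_mx0l -{1}(submxK (H _)) mul_row_block row_mxKr.
by rewrite mul0mx add0r.
Qed.

Lemma mul_graph_deriv x (u : 'rV[R]_dx) : u *m P x = row_mx u (u *m solution_deriv x).
Proof. by rewrite mul_mx_row mulmx1. Qed.

(** The differentiated constraint: [solution_deriv] solves H_xy + D H_yy = 0, and H_yy is invertible
    by coercivity. *)
Lemma rsubmx_graph_deriv x (u : 'rV[R]_dx) : rsubmx (u *m P x *m H (z x)) = 0.
Proof.
have U := coercive_unitmx m0 (drsubmx_coercive x (y x)).
rewrite -mulmxA /graph_deriv -{1}(submxK (H (z x))) mul_row_block mul_mx_row row_mxKr.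
by rewrite mul1mx /solution_deriv !mulNmx -mulmxA mulVmx // mulmx1 subrr mulmx0.
Qed.

(** For the second block [w] of [u *m P x], coercivity and the differentiated constraint give m
    |w|^2 <= - (u, 0) H (0, w)^T <= L |u| |w|. *)
Lemma graph_deriv_le x u : enorm (u *m P x) <= (1 + L / m) * enorm u.
Proof.
rewrite mul_graph_deriv; set w := u *m _.
apply: le_trans (enorm_row_mx _ _) _; rewrite mulrDl mul1r lerD2l.
rewrite mulrAC ler_pdivlMr //.
have [->|w0] := eqVneq w 0.
  rewrite enorm0 mul0r; have [->|u0] := eqVneq u 0; first by rewrite enorm0 mulr0.
  rewrite mulr_ge0 ?enorm_ge0 //.
  (* For nonzero [u], nonnegativity of [L] follows from the bound on the Hessian form. *)
  have := HL 0 (row_mx u 0) (row_mx u 0); rewrite enorm_row_mx0r.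
  move=> /(le_trans (normr_ge0 _)).
  by rewrite -mulrA pmulr_lge0 // mulr_gt0 // enorm_gt0.
have w1 := enorm_gt0 w0.
rewrite mulrC -(ler_pM2r w1) -mulrA -expr2.
apply: le_trans (hessian_coercive x (y x) w) _.
have -> : row_mx 0 w = u *m P x - row_mx u 0.
  by rewrite mul_graph_deriv opp_row_mx add_row_mx subrr subr0.
rewrite {1}mulmxBl dotBl.
have -> : u *m P x - row_mx u 0 = row_mx 0 w.
  by rewrite mul_graph_deriv opp_row_mx add_row_mx subrr subr0.
rewrite dot_row_mx0l rsubmx_graph_deriv dot0l sub0r.
have := HL (z x) (row_mx u 0) (row_mx 0 w).
by rewrite enorm_row_mx0r enorm_row_mx0l ler_norml => /andP[+ _]; lra.
Qed.

(** The remainder of [z] has the form (0, w). Tested against (0, w), the Hessian sees only the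
    Taylor remainder of [G], since the second block of [G] vanishes at both graph points; coercivity
    then bounds w, and the Lipschitz bound on [z] makes it o(|q - x|). *)
Lemma is_diff_graph_pt x : is_diff x z (fun v => v *m P x).
Proof.
apply: eps_is_diff => e e0.
pose C := 1 + L / m.
have C0 : 0 < `|C| + 1 by rewrite ltr_wpDl.
(* The divisors absorb the norm comparison and the Lipschitz factor of [z], and [m] the coercivity
   constant; [|C| + 1] is positive whatever the sign of [C]. *)
have [|d d0 Hd] := is_diff_eps (dG (z x)) (e := e * m / ((dx + dy)%:R + 1) / (`|C| + 1)).
  by rewrite !divr_gt0 // ?mulr_gt0 // ltr_wpDl.
exists (d / (`|C| + 1)); first by rewrite divr_gt0.
move=> q qx.
have zq : enorm (z q - z x) <= (`|C| + 1) * enorm (q - x).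
  apply: le_trans (enorm_graph_pt_le _ _) _; rewrite ler_wpM2r ?enorm_ge0 //.
  by rewrite -/C; apply: le_trans (ler_norm C) _; rewrite lerDl.
have /Hd {}Hd : enorm (z q - z x) < d.
  by apply: le_lt_trans zq _; rewrite mulrC -ltr_pdivlMr.
set r := z q - z x - (q - x) *m P x.
pose w := y q - y x - (q - x) *m solution_deriv x.
have rw : r = row_mx 0 w.
  by rewrite /r mul_graph_deriv /z !opp_row_mx !add_row_mx subrr.
have [w_eq0|w0] := eqVneq w 0.
  by rewrite rw w_eq0 row_mx0 enorm0 mulr_ge0 ?enorm_ge0 // ltW.
rewrite rw enorm_row_mx0l; have w1 := enorm_gt0 w0.
have B : enorm (G (z q) - G (z x) - (z q - z x) *m H (z x)) <= e * m * enorm (q - x).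
  apply: le_trans (enorm_le_mx_norm _) _.
  apply: (@le_trans _ _ (((dx + dy)%:R + 1) *
     (e * m / ((dx + dy)%:R + 1) / (`|C| + 1) * ((`|C| + 1) * enorm (q - x))))).
    apply: ler_pM => //; first by rewrite lerDl.
    apply: le_trans Hd _; rewrite ler_wpM2l //.
    by rewrite !divr_ge0 ?mulr_ge0 ?addr_ge0 // ltW.
  rewrite [leLHS](_ : _ = e * m * enorm (q - x)) //; field.
  by rewrite !gt_eqF //= ltr_wpDl.
rewrite -(ler_pM2l m0) -(ler_pM2r w1) -mulrA -expr2.
apply: le_trans (hessian_coercive x (y x) w) _.
rewrite -/(z x) -{1}rw /r mulmxBl dotBl (dot_row_mx0l ((q - x) *m P x *m _)).
rewrite rsubmx_graph_deriv dot0l subr0.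
have -> : dot ((z q - z x) *m H (z x)) (row_mx 0 w) =
   dot (- (G (z q) - G (z x) - (z q - z x) *m H (z x))) (row_mx 0 w).
  have E : rsubmx (G (z q) - G (z x)) = 0 by rewrite linearB /= !rsubmx_graph_pt subrr.
  by rewrite dotNl [in RHS]dotBl [X in - (X - _)]dot_row_mx0l E dot0l sub0r opprK.
apply: le_trans (dot_le _ _) _; rewrite enormN enorm_row_mx0l ler_pM2r //.
by rewrite mulrA (mulrC m).
Qed.

Variable J : 'rV[R]_(dx + dy) -> R.
Hypothesis dJ : forall p, is_diff p J (dot (G p)).

(** Envelope theorem: the variation of [y] is paired with the second block of [G], which vanishes on
    the graph. *)
Lemma is_diff_envelope x : is_diff x (J \o z) (dot (lsubmx (G (z x)))).
Proof.
have := is_diff_comp (is_diff_graph_pt x) (dJ (z x)).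
rewrite (_ : dot (G (z x)) \o (fun v => v *m P x) = dot (lsubmx (G (z x)))) //.
by apply/funext => v /=; rewrite mul_graph_deriv dot_rsubmx0 // rsubmx_graph_pt.
Qed.

Lemma gradient_envelope x : gradient (J \o z) x = lsubmx (G (z x)).
Proof. exact: is_diff_gradient (is_diff_envelope x). Qed.

Lemma is_diff_gradient_envelope x :
  is_diff x (gradient (J \o z)) (fun v => v *m lsubmx (P x *m H (z x))).
Proof.
(* Extraction of the first block is written as a product with a constant matrix, to which the chain
   rule applies. *)
have -> : gradient (J \o z) = (fun q => G (z q) *m col_mx 1%:M 0).
  apply/funext => q; rewrite gradient_envelope -{2}(hsubmxK (G _)) mul_row_col.
  by rewrite mulmx0 mulmx1 addr0.
have -> : (fun v : 'rV[R]_dx => v *m lsubmx (P x *m H (z x))) =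
          (fun v : 'rV[R]_dx => v *m P x *m H (z x) *m col_mx 1%:M 0).
  apply/funext => v; rewrite -!mulmxA; congr (v *m _).
  rewrite [in RHS]mulmxA -[in RHS](hsubmxK (P x *m H (z x))) mul_row_col.
  by rewrite mulmx0 mulmx1 addr0.
apply: is_diff_mulmxr.
exact: (is_diff_comp (is_diff_graph_pt x) (dG (z x))).
Qed.

Variables (f : 'rV[R]_(dx + dy) -> R) (F : 'rV[R]_(dx + dy) -> 'rV[R]_(dx + dy)).
Variables (K : 'rV[R]_(dx + dy) -> 'M[R]_(dx + dy)).
Variables (T : 'rV[R]_(dx + dy) -> 'rV[R]_(dx + dy) -> 'M[R]_(dx + dy)).
Variables (Lf rho : R).
Hypothesis df : forall p, is_diff p f (dot (F p)).
Hypothesis dF : forall p, is_diff p F (fun v => v *m K p).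
Hypothesis dH : forall p, is_diff p H (T p).
Hypothesis FL : forall p q, enorm (F p - F q) <= Lf * enorm (p - q).
Hypothesis Hlip : forall p q u v,
  `|dot (u *m (H p - H q)) v| <= rho * enorm (p - q) * enorm u * enorm v.
Hypothesis Hsym : forall p u v, dot (u *m H p) v = dot (v *m H p) u.
Hypotheses (L0 : 0 <= L) (Lf0 : 0 <= Lf) (rho0 : 0 <= rho).

(* The Lagrange multiplier of the constraint [G z = (_, 0)] for the objective f. *)
Definition multiplier x : 'rV[R]_dy :=
  - rsubmx (F (z x)) *m invmx (drsubmx (H (z x))).

Local Notation zeta x := (row_mx (0 : 'rV[R]_dx) (multiplier x)).

Lemma rsubmx_multiplier x : rsubmx (F (z x) + zeta x *m H (z x)) = 0.
Proof.
have U := coercive_unitmx m0 (drsubmx_coercive x (y x)).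
rewrite linearD /= -(submxK (H (z x))) mul_row_block row_mxKr mul0mx add0r.
by rewrite /multiplier !mulNmx -mulmxA mulVmx // mulmx1 subrr.
Qed.

(** The differentiated constraint, transposed by symmetry of the Hessian. *)
Lemma dot_graph_deriv0 x w e : dot (row_mx 0 w *m H (z x)) (e *m P x) = 0.
Proof. by rewrite Hsym dot_row_mx0l rsubmx_graph_deriv dot0l. Qed.

Lemma dot_multiplier x a e :
  dot (F (z x) + zeta x *m H (z x)) (row_mx e a) =
  dot (lsubmx (F (z x) + zeta x *m H (z x))) e.
Proof. by rewrite dot_rsubmx0 // rsubmx_multiplier. Qed.

(** Adding [zeta x *m H (z x)] leaves the pairing with tangent vectors [v *m P x] unchanged and
    cancels the second block. *)
Lemma is_diff_implicit x :
  is_diff x (f \o z) (dot (lsubmx (F (z x) + zeta x *m H (z x)))).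
Proof.
have := is_diff_comp (is_diff_graph_pt x) (df (z x)).
rewrite (_ : dot (F (z x)) \o (fun v => v *m P x) =
  dot (lsubmx (F (z x) + zeta x *m H (z x)))) //.
apply/funext => v /=; rewrite -(dot_multiplier _ (v *m solution_deriv x)).
by rewrite -mul_graph_deriv dotDl dot_graph_deriv0 addr0.
Qed.

Lemma gradient_implicit x :
  gradient (f \o z) x = lsubmx (F (z x) + zeta x *m H (z x)).
Proof. exact: is_diff_gradient (is_diff_implicit x). Qed.

(** The multiplier equations at [q] and [x] are subtracted, and coercivity of [H (z q)] bounds the
    difference of the multipliers. *)
Lemma multiplier_continuous x q : enorm (multiplier q - multiplier x) <=
  (Lf + rho * enorm (multiplier x)) / m * enorm (z q - z x).
Proof.
set w := multiplier q - multiplier x.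
rewrite mulrAC ler_pdivlMr // mulrC; apply: le_trans (_ : m * enorm w <= _) _ => //.
have [->|w0] := eqVneq w 0.
  by rewrite enorm0 mulr0 mulr_ge0 ?addr_ge0 ?mulr_ge0 ?enorm_ge0.
have w1 := enorm_gt0 w0; rewrite -(ler_pM2r w1) -mulrA -expr2.
apply: le_trans (hessian_coercive q (y q) w) _; rewrite -/(z q).
have -> : row_mx 0 w *m H (z q) = zeta q *m H (z q) - zeta x *m H (z q).
  by rewrite -mulmxBl opp_row_mx add_row_mx subrr.
have -> : dot (zeta q *m H (z q) - zeta x *m H (z q)) (row_mx 0 w) =
    - dot (F (z q) - F (z x)) (row_mx 0 w)
    - dot (zeta x *m (H (z q) - H (z x))) (row_mx 0 w).
  have := dot_multiplier q w 0; have := dot_multiplier x w 0.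
  rewrite !dot0r mulmxBr !dotBl !dotDl; lra.
apply: le_trans (ler_norm _) _; apply: le_trans (ler_normB _ _) _.
rewrite normrN mulrDl mulrDl; apply: lerD.
  apply: le_trans (dot_norm_le _ _) _; rewrite enorm_row_mx0l ler_pM2r //.
apply: le_trans (Hlip _ _ _ _) _; rewrite !enorm_row_mx0l.
by rewrite -(mulrA rho) (mulrC (enorm (z q - _))) mulrA.
Qed.

(** Freezing the multiplier at [x] costs only second order: the error is the change of multiplier
    times [H (z q)] on the range of [P x], where [H (z q)] may be replaced by [H (z q) - H (z x)],
    so two first-order factors are multiplied. *)
Lemma gradient_implicit_taylor x q :
  enorm (gradient (f \o z) q - (F (z q) + zeta x *m H (z q)) *m (P x)^T) <=
  rho * (1 + L / m) ^+ 3 * ((Lf + rho * enorm (multiplier x)) / m) *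
    enorm (q - x) ^+ 2.
Proof.
have c0 : 0 <= 1 + L / m by rewrite addr_ge0 // divr_ge0 // ltW.
have b0 : 0 <= (Lf + rho * enorm (multiplier x)) / m.
  by rewrite divr_ge0 ?addr_ge0 ?mulr_ge0 ?enorm_ge0 // ltW.
set B := (Lf + _) / m in b0 *; set C := 1 + L / m in c0 *.
apply: enorm_le_dot.
  apply: mulr_ge0; last by rewrite exprn_ge0 // enorm_ge0.
  by apply: mulr_ge0 => //; apply: mulr_ge0 => //; exact: exprn_ge0.
(* The second block vanishes at [q], so the test vector [e] may be completed to [e *m P x], with [P]
   taken at [x]. *)
move=> e; rewrite dotBl gradient_implicit -(dot_multiplier _ (e *m solution_deriv x)).
rewrite -mul_graph_deriv [X in _ - X]dot_mulmx trmxK -dotBl opprD addrACA subrr add0r.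
rewrite -mulmxBl opp_row_mx add_row_mx subrr.
set w := _ - multiplier x.
have -> : dot (row_mx 0 w *m H (z q)) (e *m P x) =
          dot (row_mx 0 w *m (H (z q) - H (z x))) (e *m P x).
  by rewrite mulmxBr dotBl dot_graph_deriv0 subr0.
apply: le_trans (ler_norm _) _; apply: le_trans (Hlip _ _ _ _) _.
rewrite enorm_row_mx0l.
have Hz : enorm (z q - z x) <= C * enorm (q - x) by exact: enorm_graph_pt_le.
have Hw : enorm w <= B * (C * enorm (q - x)).
  by apply: le_trans (multiplier_continuous _ _) _; rewrite ler_wpM2l.
have He : enorm (e *m P x) <= C * enorm e by exact: graph_deriv_le.
apply: (@le_trans _ _ (rho * (C * enorm (q - x)) * (B * (C * enorm (q - x))) * (C * enorm e))).
  apply: ler_pM; rewrite ?mulr_ge0 ?enorm_ge0 //.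
  apply: ler_pM; rewrite ?mulr_ge0 ?enorm_ge0 //.
  by apply: ler_pM; rewrite ?mulr_ge0 ?enorm_ge0.
by rewrite [leLHS](_ : _ = rho * C ^+ 3 * B * enorm (q - x) ^+ 2 * enorm e) //; ring.
Qed.

(** The gradient agrees to second order at [x] with [Phi], where the multiplier is frozen. Hence the
    two have the same derivative at [x], and that of [Phi] comes from the chain rule without
    differentiating the multiplier. *)
Lemma hessian_implicit x : exists2 A : 'M[R]_dx,
  is_diff x (gradient (f \o z)) (fun v => v *m A) &
  forall u e, dot (u *m A) e = dot (u *m P x *m K (z x)) (e *m P x) +
    dot (zeta x *m T (z x) (u *m P x)) (e *m P x).
Proof.
pose Phi q := (F (z q) + zeta x *m H (z q)) *m (P x)^T.
have dPhi : is_diff x Phi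
    (fun u => (u *m P x *m K (z x) + zeta x *m T (z x) (u *m P x)) *m (P x)^T).
  apply: is_diff_mulmxr; apply: is_diffD.
    exact: (is_diff_comp (is_diff_graph_pt x) (dF (z x))).
  apply: (is_diff_mulmxl (F := H \o z) (D := T (z x) \o (fun u => u *m P x))).
  exact: (is_diff_comp (is_diff_graph_pt x) (dH (z x))).
have JE u : u *m jacobian Phi x =
    (u *m P x *m K (z x) + zeta x *m T (z x) (u *m P x)) *m (P x)^T.
  have [dP E1] := dPhi; have [_ E2] := jacobianE dP.
  by rewrite -[RHS](congr1 (@^~ u) E1) E2.
exists (jacobian Phi x); last first.
  by move=> u e; rewrite JE [LHS]dot_mulmx trmxK dotDl.
pose C := rho * (1 + L / m) ^+ 3 * ((Lf + rho * enorm (multiplier x)) / m).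
have C0 : 0 < `|C| + 1 by rewrite ltr_wpDl.
have T2 q : enorm (gradient (f \o z) q - Phi q) <= (`|C| + 1) * enorm (q - x) ^+ 2.
  apply: le_trans (gradient_implicit_taylor x q) _; rewrite -/C.
  by rewrite ler_wpM2r ?exprn_ge0 ?enorm_ge0 // (le_trans (ler_norm C)) // lerDl.
have gx : gradient (f \o z) x = Phi x.
  have := T2 x; rewrite subrr enorm0 expr0n mulr0 => H0.
  have : enorm (gradient (f \o z) x - Phi x) = 0.
    by apply/eqP; rewrite eq_le H0 enorm_ge0.
  by move=> /enorm_eq0/subr0_eq.
apply: eps_is_diff => a a0.
have [dP _] := dPhi.
have a20 : 0 < a / 2 / (dx%:R + 1) by rewrite !divr_gt0 // ltr_wpDl.
have [d d0 Hd] := is_diff_eps (jacobianE dP) a20.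
(* Half of [a] pays for the quadratic error, the other half for the expansion of [Phi]. *)
exists (Num.min d (a / 2 / (`|C| + 1))); first by rewrite lt_min d0 !divr_gt0.
move=> q; rewrite lt_min => /andP[qd qa].
have -> : gradient (f \o z) q - gradient (f \o z) x - (q - x) *m jacobian Phi x =
   (gradient (f \o z) q - Phi q) + (Phi q - Phi x - (q - x) *m jacobian Phi x).
  by rewrite gx !addrA subrK.
apply: le_trans (enormD _ _) _; rewrite [a in _ <= a * _]splitr mulrDl; apply: lerD.
  apply: le_trans (T2 q) _; rewrite expr2 mulrA ler_wpM2r ?enorm_ge0 //.
  by rewrite mulrC -ler_pdivlMr // ltW.
apply: le_trans (enorm_le_mx_norm _) _.
apply: (@le_trans _ _ ((dx%:R + 1) * (a / 2 / (dx%:R + 1) * enorm (q - x)))).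
  by apply: ler_pM => //; [rewrite lerDl | exact: Hd].
rewrite [leLHS](_ : _ = a / 2 * enorm (q - x)) //; field.
by rewrite gt_eqF // ltr_wpDl.
Qed.

End ImplicitFunction.

(** * The comparison of the two Hessians at a point *)

Section Constants.
Context (R : realType).
Variables (mu C_f L_f L_g rho_f rho_g nu_g : R).
Hypotheses (mu0 : 0 < mu) (C_f0 : 0 <= C_f) (L_f0 : 0 <= L_f) (muL : mu <= L_g).
Hypotheses (rho_f0 : 0 <= rho_f) (rho_g0 : 0 <= rho_g) (nu_g0 : 0 <= nu_g).

Definition D2_const : R := (1 / mu + 2 * L_g / mu ^+ 2) * (L_f + C_f * rho_g / mu).

Definition D6_const : R := 2 * L_g * D2_const ^+ 2 +
  (1 + L_g / mu) ^+ 2 *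
    (C_f * rho_f / mu + C_f * L_f * rho_g / mu ^+ 2 +
     C_f ^+ 2 * nu_g / (2 * mu ^+ 2) + C_f ^+ 2 * rho_g ^+ 2 / (2 * mu ^+ 3)).

(* After dividing every constant by mu, each lies in [0, kappa] with kappa >= 1,
   and D6 / mu is a polynomial of degree 7 with nonnegative coefficients. *)
Lemma D6_const_le (ell : R) : C_f <= ell -> L_f <= ell -> L_g <= ell ->
  rho_g <= ell -> rho_f <= ell -> nu_g <= ell ->
  D6_const <= 84 * (ell * (ell / mu) ^+ 6).
Proof.
have mun0 : mu != 0 by rewrite gt_eqF.
move=> HC HL HG Hr Hs Hn; pose k := ell / mu.
have bd a : 0 <= a -> a <= ell -> exists2 b, a = b * mu & 0 <= b <= k.
  move=> a0 al; exists (a / mu); first by rewrite divfK.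
  by rewrite divr_ge0 ?(ltW mu0) //= ler_pM2r ?invr_gt0.
have [c cE /andP[c0 ck]] := bd _ C_f0 HC.
have [l lE /andP[l0 lk]] := bd _ L_f0 HL.
have [g gE /andP[g0 gk]] := bd _ (le_trans (ltW mu0) muL) HG.
have [r rE /andP[r0 rk]] := bd _ rho_g0 Hr.
have [s sE /andP[s0 sk]] := bd _ rho_f0 Hs.
have [n nE /andP[n0 nk]] := bd _ nu_g0 Hn.
have k1 : 1 <= k by rewrite ler_pdivlMr // mul1r (le_trans muL).
have k0 : 0 <= k by exact: le_trans ler01 k1.
have -> : D6_const = mu * (2 * g * ((1 + 2 * g) * (l + c * r)) ^+ 2 +
   (1 + g) ^+ 2 * (c * s + c * l * r + c ^+ 2 * n / 2 + c ^+ 2 * r ^+ 2 / 2)).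
  by rewrite /D6_const /D2_const cE lE gE rE sE nE; field.
have -> : 84 * (ell * (ell / mu) ^+ 6) = mu * (84 * k ^+ 7).
  by rewrite /k; field.
rewrite ler_pM2l //.
have kX i j : (i <= j)%N -> k ^+ i <= k ^+ j by move=> ij; apply: ler_weXn2l.
have X i a b : 0 <= a -> 0 <= b -> a <= k ^+ i -> b <= k -> a * b <= k ^+ i.+1.
  by move=> a0 b0 ai bk; rewrite exprSr ler_pM.
have cr : c * r <= k ^+ 2 by apply: X => //; rewrite expr1.
have cs : c * s <= k ^+ 2 by apply: X => //; rewrite expr1.
have cl : c * l <= k ^+ 2 by apply: X => //; rewrite expr1.
have clr : c * l * r <= k ^+ 3 by apply: X => //; rewrite mulr_ge0.
have cc : c ^+ 2 <= k ^+ 2 by rewrite expr2; apply: X => //; rewrite expr1.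
have ccn : c ^+ 2 * n <= k ^+ 3 by apply: X => //; rewrite exprn_ge0.
have ccr1 : c ^+ 2 * r <= k ^+ 3 by apply: X => //; rewrite exprn_ge0.
have ccr : c ^+ 2 * r ^+ 2 <= k ^+ 4.
  by rewrite (expr2 r) mulrA; apply: X => //; rewrite mulr_ge0 // exprn_ge0.
have d2 : (1 + 2 * g) * (l + c * r) <= 6 * k ^+ 3.
  have h1 : 1 + 2 * g <= 3 * k by lra.
  have h2 : l + c * r <= 2 * k ^+ 2 by have := @kX 1%N 2%N isT; rewrite expr1; lra.
  rewrite (_ : 6 * k ^+ 3 = (3 * k) * (2 * k ^+ 2)); last by ring.
  by apply: ler_pM => //; rewrite addr_ge0 // mulr_ge0.
have d20 : 0 <= (1 + 2 * g) * (l + c * r).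
  by rewrite mulr_ge0 // addr_ge0 // mulr_ge0.
(* The constant 84 is 72 + 12, with 72 = 2 * 6^2 from this term and 12 = 4 * 3 from the next. *)
have t1 : 2 * g * ((1 + 2 * g) * (l + c * r)) ^+ 2 <= 72 * k ^+ 7.
  rewrite (_ : 72 * k ^+ 7 = (2 * k) * (6 * k ^+ 3) ^+ 2); last by ring.
  have d22 : ((1 + 2 * g) * (l + c * r)) ^+ 2 <= (6 * k ^+ 3) ^+ 2.
    by rewrite lerXn2r // nnegrE // (le_trans d20).
  by apply: ler_pM; [rewrite mulr_ge0 | rewrite exprn_ge0 | rewrite ler_pM2l | exact: d22].
have t2 : (1 + g) ^+ 2 * (c * s + c * l * r + c ^+ 2 * n / 2 + c ^+ 2 * r ^+ 2 / 2)
    <= 12 * k ^+ 7.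
  have h1 : (1 + g) ^+ 2 <= 4 * k ^+ 2.
    rewrite (_ : 4 * k ^+ 2 = (2 * k) ^+ 2); last by ring.
    by rewrite lerXn2r // ?nnegrE; lra.
  have h2 : c * s + c * l * r + c ^+ 2 * n / 2 + c ^+ 2 * r ^+ 2 / 2 <= 3 * k ^+ 4.
    by have := @kX 2%N 4%N isT; have := @kX 3%N 4%N isT; lra.
  apply: (@le_trans _ _ ((4 * k ^+ 2) * (3 * k ^+ 4))).
    by apply: ler_pM; rewrite // ?exprn_ge0 ?addr_ge0 ?mulr_ge0 ?exprn_ge0 // invr_ge0.
  by have := @kX 6%N 7%N isT; rewrite [_ * (3 * _)](_ : _ = 12 * k ^+ 6); [lra | ring].
by lra.
Qed.

(* The slack between the perturbation estimate and [2 * L_g * D2 ^+ 2]. *)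
Lemma D2_slack (e : R) : 0 <= e ->
  2 * (1 + L_g / mu) ^+ 2 * e ^+ 2 / mu <=
  2 * L_g * ((1 / mu + 2 * L_g / mu ^+ 2) * e) ^+ 2.
Proof.
move=> e0; have mun0 : mu != 0 by rewrite gt_eqF.
pose g := L_g / mu; have g1 : 1 <= g by rewrite ler_pdivlMr // mul1r.
have -> : 2 * L_g * ((1 / mu + 2 * L_g / mu ^+ 2) * e) ^+ 2 =
   (2 * e ^+ 2 / mu) * (g * (1 + 2 * g) ^+ 2) by rewrite /g; field.
have -> : 2 * (1 + L_g / mu) ^+ 2 * e ^+ 2 / mu = (2 * e ^+ 2 / mu) * (1 + g) ^+ 2.
  by rewrite /g; field.
apply: ler_wpM2l; first by rewrite divr_ge0 ?mulr_ge0 ?exprn_ge0 // ltW.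
apply: (@le_trans _ _ ((1 + 2 * g) ^+ 2)); first by rewrite lerXn2r ?nnegrE //; lra.
by rewrite ler_peMl // exprn_ge0 //; lra.
Qed.

End Constants.

(** * Perturbation estimates at a fixed [x], on abstract derivative data *)

Section Comparison.
Context (R : realType) (dx dy : nat).
Local Notation V := 'rV[R]_(dx + dy).
Local Notation W := 'M[R]_(dx + dy).
(* Index 0 refers to the point z0 = (x, y^*(x)), index 1 to z1 = (x, y^*_lambda(x)). *)
Variables (mu C_f L_f L_g rho_f rho_g nu_g lambda : R).
Variables (F0 F1 G0 G1 : V) (H0 H1 K0 K1 : W) (T0 : V -> W).
Variables (delta beta : 'rV[R]_dy).
Local Notation d := (row_mx (0 : 'rV[R]_dx) delta).
Local Notation zeta := (row_mx (0 : 'rV[R]_dx) beta).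
Hypotheses (mu0 : 0 < mu) (lambda0 : 0 < lambda) (muL : mu <= L_g).
Hypotheses (L_f0 : 0 <= L_f) (C_f0 : 0 <= C_f).
Hypotheses (rho_f0 : 0 <= rho_f) (rho_g0 : 0 <= rho_g) (nu_g0 : 0 <= nu_g).
Hypothesis G0E : rsubmx G0 = 0.
Hypothesis G1E : rsubmx (F1 + lambda *: G1) = 0.
Hypothesis zetaE : rsubmx (F0 + zeta *m H0) = 0.
Hypothesis F1_le : forall v, `|dot (rsubmx F1) v| <= C_f * enorm v.
Hypothesis dF_le : enorm (F1 - F0) <= L_f * enorm delta.
Hypothesis dG_mono : mu * enorm delta ^+ 2 <= dot (rsubmx G1 - rsubmx G0) delta.
Hypothesis dG_taylor : forall v,
  `|dot (G1 - G0 - d *m H0) v| <= rho_g / 2 * enorm d ^+ 2 * enorm v.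
Hypothesis H0_coercive : forall v : 'rV[R]_dy,
  mu * enorm v ^+ 2 <= dot (row_mx 0 v *m H0) (row_mx 0 v).
Hypothesis dK_le : forall u v, `|dot (u *m (K1 - K0)) v| <= rho_f * enorm d * enorm u * enorm v.
Hypothesis K1_le : forall u v, `|dot (u *m K1) v| <= L_f * enorm u * enorm v.
Hypothesis dH_le : forall u v, `|dot (u *m (H1 - H0)) v| <= rho_g * enorm d * enorm u * enorm v.
Hypothesis dH_taylor : forall u v,
  `|dot (u *m (H1 - H0 - T0 d)) v| <= nu_g / 2 * enorm d ^+ 2 * enorm u * enorm v.
Hypothesis T0_le : forall u v w, `|dot (u *m T0 w) v| <= rho_g * enorm w * enorm u * enorm v.
Hypothesis T0_lin : forall a u v, T0 (a *: u + v) = a *: T0 u + T0 v.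

Let mu_neq0 : mu != 0. Proof. by rewrite gt_eqF. Qed.
Let lambda_neq0 : lambda != 0. Proof. by rewrite gt_eqF. Qed.

(** The stationarity conditions at both points are paired with [delta]: lambda mu |delta|^2 is at
    most minus the pairing of the second block of [F1] with [delta]. *)
Lemma displacement_le : enorm delta <= C_f / (lambda * mu).
Proof.
have [->|d0] := eqVneq delta 0.
  by rewrite enorm0 divr_ge0 // mulr_ge0 // ltW.
have d1 := enorm_gt0 d0.
rewrite ler_pdivlMr ?mulr_gt0 // -(ler_pM2r d1).
have : lambda * (mu * enorm delta ^+ 2) <= C_f * enorm delta.
  apply: (@le_trans _ _ (lambda * dot (rsubmx G1) delta)).
    by rewrite ler_pM2l //; move: dG_mono; rewrite G0E subr0.
  have : dot (rsubmx F1) delta + lambda * dot (rsubmx G1) delta = 0.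
    by rewrite -dotZl -dotDl -linearZ -linearD /= G1E dot0l.
  by have := F1_le delta; rewrite ler_norml => /andP[+ _]; lra.
by rewrite expr2; lra.
Qed.

(** On the second block, the equations for z0, z1 and [zeta] turn [row_mx 0 b *m H0] into - (F1 -
    F0) - lambda (G1 - G0 - d H0). Both terms are O(1 / lambda) by [displacement_le], and coercivity
    of [H0] bounds [b]. *)
Lemma multiplier_error_le : enorm (lambda *: delta - beta) <=
  (rho_g * C_f ^+ 2 / (2 * mu ^+ 2) + L_f * C_f / mu) / mu / lambda.
Proof.
set b := lambda *: delta - beta.
have dle := displacement_le; have dge := enorm_ge0 delta.
have [->|b0] := eqVneq b 0.
  by rewrite enorm0 !divr_ge0 ?addr_ge0 ?divr_ge0 ?mulr_ge0 ?exprn_ge0 // ltW.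
have b1 := enorm_gt0 b0.
apply: (@le_trans _ _ ((lambda * (rho_g / 2 * enorm delta ^+ 2) + L_f * enorm delta) / mu)).
  rewrite ler_pdivlMr // -(ler_pM2r b1).
  have := H0_coercive b.
  have -> : row_mx 0 b *m H0 = lambda *: (d *m H0) - zeta *m H0.
    by rewrite scalemxAl -mulmxBl scale_row_mx opp_row_mx add_row_mx scaler0 subrr.
  have E1 : dot (zeta *m H0) (row_mx 0 b) = - dot F0 (row_mx 0 b).
    have : dot (F0 + zeta *m H0) (row_mx 0 b) = 0 by rewrite dot_row_mx0l zetaE dot0l.
    by rewrite dotDl; lra.
  have E2 : lambda * dot G1 (row_mx 0 b) = - dot F1 (row_mx 0 b).
    have : dot (F1 + lambda *: G1) (row_mx 0 b) = 0 by rewrite dot_row_mx0l G1E dot0l.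
    by rewrite dotDl dotZl; lra.
  have E3 : dot G0 (row_mx 0 b) = 0 by rewrite dot_row_mx0l G0E dot0l.
  have B1 := dG_taylor (row_mx 0 b).
  have B2 : `|dot (F1 - F0) (row_mx 0 b)| <= L_f * enorm delta * enorm b.
    apply: le_trans (dot_norm_le _ _) _; rewrite enorm_row_mx0l.
    by rewrite ler_wpM2r ?enorm_ge0.
  rewrite !enorm_row_mx0l !dotBl !ler_norml ?E3 ?subr0 in B1 B2.
  case/andP: B1 => B1 _; case/andP: B2 => B2 _.
  have B1l := ler_wpM2l (ltW lambda0) B1.
  rewrite dotBl dotZl E1 expr2; lra.
rewrite (_ : (rho_g * C_f ^+ 2 / (2 * mu ^+ 2) + L_f * C_f / mu) / mu / lambda =
  (lambda * (rho_g / 2 * (C_f / (lambda * mu)) ^+ 2) + L_f * (C_f / (lambda * mu))) / mu).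
  rewrite ler_pM2r ?invr_gt0 // lerD // ?ler_wpM2l //; first exact: ltW.
    by rewrite divr_ge0.
  by rewrite lerXn2r // nnegrE // divr_ge0 // mulr_ge0 // ltW.
by field; rewrite mu_neq0.
Qed.

Local Notation N := (K1 + lambda *: (H1 - H0)).

(** The bound is uniform in [lambda], because the displacement is of order 1 / lambda. *)
Lemma hessian_gap_le u v :
  `|dot (u *m N) v| <= (L_f + C_f * rho_g / mu) * enorm u * enorm v.
Proof.
rewrite mulmxDr dotDl -scalemxAr dotZl; apply: le_trans (ler_normD _ _) _.
rewrite !mulrDl; apply: lerD; first exact: K1_le.
rewrite normrM gtr0_norm //.
apply: (@le_trans _ _ (lambda * (rho_g * (C_f / (lambda * mu)) * enorm u * enorm v))).
  rewrite ler_pM2l //; apply: le_trans (dH_le _ _) _; rewrite enorm_row_mx0l.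
  by rewrite !ler_wpM2r ?enorm_ge0 // ler_wpM2l // displacement_le.
by rewrite [leLHS](_ : _ = C_f * rho_g / mu * enorm u * enorm v) //; field; rewrite mu_neq0.
Qed.

(** The matrix splits as (K1 - K0) + lambda (H1 - H0 - T0 d) + T0 (0, lambda delta - beta); each
    summand is O(1 / lambda). *)
Lemma hessian_second_order_le u v :
  `|dot (u *m (N - K0 - T0 zeta)) v| <=
  (C_f * rho_f / mu + C_f * L_f * rho_g / mu ^+ 2 + C_f ^+ 2 * nu_g / (2 * mu ^+ 2)
   + C_f ^+ 2 * rho_g ^+ 2 / (2 * mu ^+ 3)) / lambda * enorm u * enorm v.
Proof.
pose b := lambda *: delta - beta.
have -> : N - K0 - T0 zeta =
    (K1 - K0) + lambda *: (H1 - H0 - T0 d) + T0 (row_mx 0 b).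
  have -> : row_mx 0 b = lambda *: d + (-1) *: zeta :> V.
    by rewrite !scale_row_mx add_row_mx !scaler0 addr0 scaleN1r.
  rewrite T0_lin -[(-1) *: zeta]addr0 T0_lin.
  have -> : T0 0 = 0.
    have := T0_lin 1 0 0; rewrite !scale1r addr0 => /esym/eqP.
    by rewrite -subr_eq0 addrK => /eqP.
  rewrite addr0 scaleN1r (scalerBr lambda (H1 - H0)) !addrA subrK.
  by rewrite (addrAC K1 (- K0)).
have e3 : enorm u * enorm v >= 0 by rewrite mulr_ge0 ?enorm_ge0.
set X1 := K1 - K0; set X2 := H1 - H0 - T0 d; set X3 := T0 (row_mx 0 b).
rewrite 2!mulmxDr 2!dotDl -scalemxAr dotZl.
have A1 : `|dot (u *m X1) v| <= rho_f * (C_f / (lambda * mu)) * (enorm u * enorm v).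
  apply: le_trans (dK_le _ _) _; rewrite -mulrA ler_wpM2r // enorm_row_mx0l.
  by rewrite ler_wpM2l // displacement_le.
have A2 : `|lambda * dot (u *m X2) v| <=
    lambda * (nu_g / 2 * (C_f / (lambda * mu)) ^+ 2 * (enorm u * enorm v)).
  rewrite normrM gtr0_norm // ler_pM2l //.
  apply: le_trans (dH_taylor _ _) _; rewrite -mulrA ler_wpM2r // enorm_row_mx0l.
  rewrite ler_wpM2l ?divr_ge0 // lerXn2r ?nnegrE ?enorm_ge0 ?displacement_le //.
  by rewrite divr_ge0 // mulr_ge0 // ltW.
have A3 : `|dot (u *m X3) v| <= rho_g *
    ((rho_g * C_f ^+ 2 / (2 * mu ^+ 2) + L_f * C_f / mu) / mu / lambda) * (enorm u * enorm v).
  apply: le_trans (T0_le _ _ _) _; rewrite -mulrA ler_wpM2r // enorm_row_mx0l.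
  by rewrite ler_wpM2l // multiplier_error_le.
have A12 := le_trans (ler_normD _ _) (lerD A1 A2).
apply: le_trans (ler_normD _ _) _; apply: le_trans (lerD A12 A3) _.
set E := enorm u * enorm v; rewrite -(mulrA _ (enorm u)) -/E.
by rewrite [leLHS](_ : _ = (C_f * rho_f / mu + C_f * L_f * rho_g / mu ^+ 2 +
  C_f ^+ 2 * nu_g / (2 * mu ^+ 2) + C_f ^+ 2 * rho_g ^+ 2 / (2 * mu ^+ 3)) / lambda * E) //;
  field; rewrite ?mu_neq0 ?lambda_neq0.
Qed.

Variables (U E : V) (w : 'rV[R]_dy) (nU nE : R).
Hypothesis U0 : rsubmx (U *m H0) = 0.
Hypothesis U1 : rsubmx ((U + row_mx 0 w) *m (K1 + lambda *: H1)) = 0.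
Hypothesis E0 : forall v : 'rV[R]_dy, dot (row_mx 0 v *m H0) E = 0.
Hypothesis H1_coercive : forall v : 'rV[R]_dy, lambda * mu / 2 * enorm v ^+ 2 <=
  dot (row_mx 0 v *m (K1 + lambda *: H1)) (row_mx 0 v).
Hypotheses (nU0 : 0 <= nU) (nE0 : 0 <= nE).
Hypotheses (nUE : enorm U <= (1 + L_g / mu) * nU) (nEE : enorm E <= (1 + L_g / mu) * nE).

Let c := 1 + L_g / mu.
Let e1 := L_f + C_f * rho_g / mu.
Let c0 : 0 <= c.
Proof. by rewrite addr_ge0 // divr_ge0 ?(ltW mu0) // (le_trans (ltW mu0)). Qed.
Let e10 : 0 <= e1.
Proof. by rewrite addr_ge0 // divr_ge0 ?(ltW mu0) // mulr_ge0. Qed.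

Let HkE : K1 + lambda *: H1 = N + lambda *: H0.
Proof. by rewrite scalerBr -addrA subrK. Qed.

(** [U] and [U + row_mx 0 w] stand for tangent vectors to the two solution graphs. As K1 + lambda H1
    = N + lambda H0, the two constraints give (0, w) (K1 + lambda H1) = - U N on the second block;
    the coercivity constant lambda mu / 2 yields the factor 2. *)
Lemma graph_deriv_gap_le : enorm w <= 2 * e1 * c * nU / (lambda * mu).
Proof.
have [->|w0] := eqVneq w 0.
  by rewrite enorm0 divr_ge0 ?mulr_ge0 // ltW.
have w1 := enorm_gt0 w0.
rewrite ler_pdivlMr ?mulr_gt0 // -(ler_pM2r w1).
have K := H1_coercive w.
have : lambda * mu / 2 * enorm w ^+ 2 <= e1 * (c * nU) * enorm w.
  apply: le_trans K _.
  have -> : dot (row_mx 0 w *m (K1 + lambda *: H1)) (row_mx 0 w) =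
      - dot (U *m N) (row_mx 0 w).
    have : dot ((U + row_mx 0 w) *m (K1 + lambda *: H1)) (row_mx 0 w) = 0.
      by rewrite dot_row_mx0l U1 dot0l.
    rewrite mulmxDl dotDl {1}HkE mulmxDr dotDl -scalemxAr dotZl.
    by rewrite (dot_row_mx0l (U *m H0)) U0 dot0l mulr0 addr0; lra.
  have := hessian_gap_le U (row_mx 0 w); rewrite ler_norml => /andP[K1' _].
  apply: (@le_trans _ _ (e1 * enorm U * enorm w)).
    by rewrite lerNl; rewrite enorm_row_mx0l in K1'.
  by rewrite ler_pM2r // ler_wpM2l.
by rewrite expr2; lra.
Qed.

(** The terms in [H0] cancel or vanish on [E], which leaves U (N - K0 - T0 zeta) E^T + (0, w) N E^T.
    The first summand gives the bracket in D6, the second its D2 term through [D2_slack]. *)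
Lemma hessian_comparison :
  dot ((U + row_mx 0 w) *m (K1 + lambda *: H1)) E - lambda * dot (U *m H0) E
   - (dot (U *m K0) E + dot (U *m T0 zeta) E) <=
  D6_const mu C_f L_f L_g rho_f rho_g nu_g / lambda * nU * nE.
Proof.
have -> : dot ((U + row_mx 0 w) *m (K1 + lambda *: H1)) E - lambda * dot (U *m H0) E
    - (dot (U *m K0) E + dot (U *m T0 zeta) E) =
   dot (U *m (N - K0 - T0 zeta)) E + dot (row_mx 0 w *m N) E.
  rewrite HkE (mulmxDr (U + _)) dotDl -scalemxAr dotZl (mulmxDl _ _ H0) dotDl E0 addr0.
  by rewrite (mulmxDl U) dotDl 2!(mulmxBr U) 2!dotBl; lra.
have A1 := le_trans (ler_norm _) (hessian_second_order_le U E).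
have A2 := le_trans (ler_norm _) (hessian_gap_le (row_mx 0 w) E).
apply: le_trans (lerD A1 A2) _; rewrite enorm_row_mx0l -/e1.
pose B := C_f * rho_f / mu + C_f * L_f * rho_g / mu ^+ 2 +
  C_f ^+ 2 * nu_g / (2 * mu ^+ 2) + C_f ^+ 2 * rho_g ^+ 2 / (2 * mu ^+ 3).
rewrite -/B.
have B0 : 0 <= B.
  by rewrite !addr_ge0 // !divr_ge0 ?mulr_ge0 ?exprn_ge0 // ?ltW.
have T1 : B / lambda * enorm U * enorm E <= c ^+ 2 * B / lambda * nU * nE.
  apply: (@le_trans _ _ (B / lambda * (c * nU) * (c * nE))).
    have Bl : 0 <= B / lambda by rewrite divr_ge0 // ltW.
    by apply: ler_pM; [rewrite mulr_ge0 ?enorm_ge0 | exact: enorm_ge0 | rewrite ler_wpM2l | ].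
  by rewrite [leLHS](_ : _ = c ^+ 2 * B / lambda * nU * nE) //; field.
have T2 : e1 * enorm w * enorm E <= 2 * L_g * D2_const mu C_f L_f L_g rho_g ^+ 2 / lambda * nU * nE.
  apply: (@le_trans _ _ (e1 * (2 * e1 * c * nU / (lambda * mu)) * (c * nE))).
    apply: ler_pM => //; [by rewrite mulr_ge0 ?enorm_ge0 | exact: enorm_ge0 | ].
    by rewrite ler_wpM2l //; exact: graph_deriv_gap_le.
  rewrite [leLHS](_ : _ = 2 * c ^+ 2 * e1 ^+ 2 / mu / lambda * nU * nE); last first.
    by field; rewrite ?mu_neq0 ?lambda_neq0.
  apply: (ler_wpM2r nE0); apply: (ler_wpM2r nU0); apply: ler_wpM2r.
    by rewrite invr_ge0 ltW.
  exact: D2_slack.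
apply: le_trans (lerD T1 T2) _.
by rewrite /D6_const -/c -/B !mulrDl addrC.
Qed.

End Comparison.

(** * The Hessians of the hyperobjective and of the penalized value function *)

Section PenaltyHessian.
Context (R : realType) (dx dy : nat).
Local Notation V := 'rV[R]_(dx + dy).
Local Notation W := 'M[R]_(dx + dy).
Variables (f g : V -> R) (F G : V -> V) (K H : V -> W) (T : V -> V -> W).
Variables (mu C_f L_f L_g rho_f rho_g nu_g lambda : R).
Variables (yg yl : 'rV[R]_dx -> 'rV[R]_dy).
Hypothesis df : forall p, is_diff p f (dot (F p)).
Hypothesis dg : forall p, is_diff p g (dot (G p)).
Hypothesis dF : forall p, is_diff p F (fun v => v *m K p).
Hypothesis dG : forall p, is_diff p G (fun v => v *m H p).
Hypothesis dH : forall p, is_diff p H (T p).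
Hypothesis Hsym : forall p u v, dot (u *m H p) v = dot (v *m H p) u.
Hypothesis Tsym : forall p u v w, dot (u *m T p w) v = dot (w *m T p u) v.
Hypothesis Tlin : forall p a u v, T p (a *: u + v) = a *: T p u + T p v.
Hypothesis FC : forall p v, `|dot (rsubmx (F p)) v| <= C_f * enorm v.
Hypothesis FL : forall p q, enorm (F p - F q) <= L_f * enorm (p - q).
Hypothesis KL : forall p u v, `|dot (u *m K p) v| <= L_f * enorm u * enorm v.
Hypothesis Klip : forall p q u v,
  `|dot (u *m (K p - K q)) v| <= rho_f * enorm (p - q) * enorm u * enorm v.
Hypothesis GL : forall p q, enorm (G p - G q) <= L_g * enorm (p - q).
Hypothesis HL : forall p u v, `|dot (u *m H p) v| <= L_g * enorm u * enorm v.
Hypothesis Hlip : forall p q u v,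
  `|dot (u *m (H p - H q)) v| <= rho_g * enorm (p - q) * enorm u * enorm v.
Hypothesis Gtaylor : forall p q v,
  `|dot (G q - G p - (q - p) *m H p) v| <= rho_g / 2 * enorm (q - p) ^+ 2 * enorm v.
Hypothesis TL : forall p u v w,
  `|dot (u *m T p w) v| <= rho_g * enorm w * enorm u * enorm v.
Hypothesis Htaylor : forall p q u v,
  `|dot (u *m (H q - H p - T p (q - p))) v| <=
    nu_g / 2 * enorm (q - p) ^+ 2 * enorm u * enorm v.
Hypothesis Gm : forall x p q, mu * enorm (p - q) ^+ 2 <=
  dot (rsubmx (G (row_mx x p)) - rsubmx (G (row_mx x q))) (p - q).
Hypotheses (mu0 : 0 < mu) (muL : mu <= L_g) (L_f0 : 0 <= L_f) (C_f0 : 0 <= C_f).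
Hypotheses (rho_f0 : 0 <= rho_f) (rho_g0 : 0 <= rho_g) (nu_g0 : 0 <= nu_g).
Hypothesis yg0 : forall x, rsubmx (G (row_mx x (yg x))) = 0.

Let L_g0 : 0 <= L_g. Proof. exact: le_trans (ltW mu0) muL. Qed.

Lemma phi_hessian x : exists2 A : 'M[R]_dx,
  is_diff x (gradient (f \o graph_pt yg)) (fun v => v *m A) &
  forall u e, dot (u *m A) e =
    dot (u *m graph_deriv H yg x *m K (graph_pt yg x)) (e *m graph_deriv H yg x) +
    dot (row_mx 0 (multiplier H yg F x) *m T (graph_pt yg x) (u *m graph_deriv H yg x))
      (e *m graph_deriv H yg x).
Proof.
exact: (hessian_implicit dG GL HL mu0 Gm yg0 df dF dH FL Hlip Hsym L_g0 L_f0 rho_g0 x).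
Qed.

Lemma twice_differentiable_phi : twice_differentiable (f \o graph_pt yg).
Proof.
split=> p; first by have [] := is_diff_implicit dG GL mu0 Gm yg0 df Hsym p.
by have [A []] := phi_hessian p.
Qed.

Hypotheses (lambda0 : 0 < lambda) (lambdaL : 2 * L_f / mu <= lambda).

Definition penalty_grad p := F p + lambda *: G p.
Definition penalty_hess p := K p + lambda *: H p.
Definition penalty p := f p + lambda * g p.
Local Notation Gk := penalty_grad.
Local Notation Hk := penalty_hess.

Lemma is_diff_penalty p : is_diff p penalty (dot (Gk p)).
Proof.
have := is_diffD (df p) (is_diffZ lambda (dg p)).
rewrite (_ : dot (F p) + _ = dot (Gk p)) //.
by apply/funext => v; rewrite /Gk dotDl dotZl.
Qed.

Lemma is_diff_penalty_grad p : is_diff p Gk (fun v => v *m Hk p).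
Proof.
have := is_diffD (dF p) (is_diffZ lambda (dG p)).
rewrite (_ : (fun v : V => v *m K p) + lambda *: (fun v : V => v *m H p) =
  (fun v => v *m Hk p)) //.
by apply/funext => v; rewrite !fctE /Hk mulmxDr -scalemxAr.
Qed.

(** The gradient of [f] can destroy at most [L_f] of the monotonicity [lambda * mu], and [L_f] is at
    most half of it. *)
Lemma penalty_grad_monotone x p q : lambda * mu / 2 * enorm (p - q) ^+ 2 <=
  dot (rsubmx (Gk (row_mx x p)) - rsubmx (Gk (row_mx x q))) (p - q).
Proof.
have lm : 2 * L_f <= lambda * mu by rewrite -ler_pdivrMr.
set d := p - q; set p' := row_mx x p; set q' := row_mx x q.
have -> : rsubmx (Gk p') - rsubmx (Gk q') =
    rsubmx (F p' - F q') + lambda *: (rsubmx (G p') - rsubmx (G q')).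
  rewrite /Gk -!linearB -linearZ -linearD /=; congr rsubmx.
  by rewrite scalerBr opprD addrACA.
have B1 : `|dot (rsubmx (F p' - F q')) d| <= L_f * enorm d ^+ 2.
  apply: le_trans (dot_norm_le _ _) _; rewrite expr2 mulrA ler_wpM2r ?enorm_ge0 //.
  apply: le_trans (enorm_rsubmx _) _; apply: le_trans (FL _ _) _.
  by rewrite opp_row_mx add_row_mx subrr enorm_row_mx0l.
have B2 := ler_wpM2l (ltW lambda0) (Gm x p q).
have B3 : 2 * L_f * enorm d ^+ 2 <= lambda * mu * enorm d ^+ 2.
  by rewrite ler_wpM2r // exprn_ge0 // enorm_ge0.
move: B1; rewrite ler_norml => /andP[B1 _].
by rewrite dotDl dotZl; rewrite -/d in B2; lra.
Qed.

Lemma penalty_grad_lipschitz p q :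
  enorm (Gk p - Gk q) <= (L_f + lambda * L_g) * enorm (p - q).
Proof.
have -> : Gk p - Gk q = (F p - F q) + lambda *: (G p - G q).
  by rewrite /Gk scalerBr opprD addrACA.
apply: le_trans (enormD _ _) _; rewrite mulrDl enormZ gtr0_norm // -mulrA.
by apply: lerD; rewrite ?FL // ler_pM2l.
Qed.

Hypothesis yl0 : forall x, rsubmx (Gk (row_mx x (yl x))) = 0.

Let m0 : 0 < lambda * mu / 2.
Proof. by rewrite divr_gt0 // mulr_gt0. Qed.

(** Each of the two terms is evaluated on the graph of its own critical points, so the envelope
    theorem applies to both. *)
Definition penalty_value x := penalty (graph_pt yl x) - lambda * g (graph_pt yg x).

Lemma is_diff_penalty_value x : is_diff x penalty_value
  (dot (lsubmx (Gk (graph_pt yl x)) - lambda *: lsubmx (G (graph_pt yg x)))).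
Proof.
have d1 := is_diff_envelope is_diff_penalty_grad penalty_grad_lipschitz m0
  penalty_grad_monotone yl0 is_diff_penalty x.
have d2 := is_diff_envelope dG GL mu0 Gm yg0 dg x.
have := is_diffB d1 (is_diffZ lambda d2).
rewrite (_ : dot _ - _ = dot (lsubmx (Gk (graph_pt yl x)) -
  lambda *: lsubmx (G (graph_pt yg x)))) //.
by apply/funext => v; rewrite dotBl dotZl.
Qed.

Lemma is_diff_gradient_penalty_value x : is_diff x (gradient penalty_value)
  (fun v => v *m (lsubmx (graph_deriv Hk yl x *m Hk (graph_pt yl x)) -
    lambda *: lsubmx (graph_deriv H yg x *m H (graph_pt yg x)))).
Proof.
have d1 := is_diff_gradient_envelope is_diff_penalty_grad penalty_grad_lipschitz m0
  penalty_grad_monotone yl0 is_diff_penalty x.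
have d2 := is_diff_gradient_envelope dG GL mu0 Gm yg0 dg x.
have := is_diffB d1 (is_diffZ lambda d2).
have -> : gradient (penalty \o graph_pt yl) - lambda *: gradient (g \o graph_pt yg) =
    gradient penalty_value.
  apply/funext => q; rewrite (is_diff_gradient (is_diff_penalty_value q)) !fctE.
  rewrite (gradient_envelope is_diff_penalty_grad penalty_grad_lipschitz m0
    penalty_grad_monotone yl0 is_diff_penalty).
  by rewrite (gradient_envelope dG GL mu0 Gm yg0 dg).
rewrite (_ : (fun v => v *m _) - lambda *: (fun v => v *m _) =
  (fun v => v *m (lsubmx (graph_deriv Hk yl x *m Hk (graph_pt yl x)) -
    lambda *: lsubmx (graph_deriv H yg x *m H (graph_pt yg x))))) //.
by apply/funext => v; rewrite !fctE mulmxBr -scalemxAr.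
Qed.

Lemma twice_differentiable_penalty_value : twice_differentiable penalty_value.
Proof.
split=> p; first by have [] := is_diff_penalty_value p.
by have [] := is_diff_gradient_penalty_value p.
Qed.

Lemma D6_const_ge0 : 0 <= D6_const mu C_f L_f L_g rho_f rho_g nu_g.
Proof.
have muV : 0 <= mu^-1 by rewrite invr_ge0 ltW.
have c0 : 0 <= 1 + L_g / mu by rewrite addr_ge0 // mulr_ge0.
rewrite /D6_const addr_ge0 //.
  by apply: mulr_ge0; [rewrite mulr_ge0 | rewrite sqr_ge0].
apply: mulr_ge0; first exact: sqr_ge0.
by rewrite !addr_ge0 // !divr_ge0 ?mulr_ge0 ?exprn_ge0 // ltW.
Qed.

Theorem penalty_hessian_gap x :
  opnorm (hessian penalty_value x - hessian (f \o graph_pt yg) x) <=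
  D6_const mu C_f L_f L_g rho_f rho_g nu_g / lambda.
Proof.
have [A dA AE] := phi_hessian x.
rewrite /hessian (is_diff_jacobian (is_diff_gradient_penalty_value x)).
rewrite (is_diff_jacobian dA).
apply: opnorm_le_dot; first by rewrite divr_ge0 ?D6_const_ge0 // ltW.
move=> u v.
set z0 := graph_pt yg x; set z1 := graph_pt yl x.
set P0 := graph_deriv H yg x; set P1 := graph_deriv Hk yl x.
pose w := u *m solution_deriv Hk yl x - u *m solution_deriv H yg x.
have P1E : u *m P1 = u *m P0 + row_mx 0 w.
  by rewrite !mul_graph_deriv add_row_mx addr0 addrC subrK.
have z10 : z1 - z0 = row_mx 0 (yl x - yg x).
  by rewrite opp_row_mx add_row_mx subrr.
have U0 : rsubmx (u *m P0 *m H z0) = 0 := rsubmx_graph_deriv yg dG mu0 Gm x u.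
have U1 : rsubmx (u *m P1 *m Hk z1) = 0 :=
  rsubmx_graph_deriv yl is_diff_penalty_grad m0 penalty_grad_monotone x u.
(* When the second block vanishes, pairing the first block with [v] equals pairing the whole row
   with [v *m P0]; both Hessians thus get the same right factor. *)
have lE (y : 'rV[R]_dx -> 'rV[R]_dy) (B : 'M[R]_(dx, dx + dy)) : rsubmx (u *m B) = 0 ->
    dot (u *m lsubmx B) v = dot (u *m B) (v *m P0).
  by move=> B0; rewrite mul_graph_deriv dot_rsubmx0 // mulmx_lsub.
rewrite mulmxBr mulmxBr dotBl dotBl -scalemxAr dotZl AE.
(* [Tsym] moves the multiplier into the direction slot of the third derivative. *)
rewrite !lE -?mulmxA // ?mulmxA // Tsym P1E.
apply: (@hessian_comparison R dx dy mu C_f L_f L_g rho_f rho_g nu_g lambda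
  (F z0) (F z1) (G z0) (G z1) (H z0) (H z1) (K z0) (K z1) (T z0) (yl x - yg x)
  (multiplier H yg F x)); rewrite -?z10 //.
- exact: yg0.
- exact: yl0.
- exact: (rsubmx_multiplier yg dG mu0 Gm).
- by rewrite -(enorm_row_mx0l dx (yl x - yg x)) -z10.
- exact: Gm.
- exact: (hessian_coercive dG Gm).
- by rewrite -P1E.
- by move=> a; apply: (dot_graph_deriv0 yg dG mu0 Gm Hsym).
- exact: (hessian_coercive is_diff_penalty_grad penalty_grad_monotone).
- exact: enorm_ge0.
- exact: enorm_ge0.
- exact: (graph_deriv_le yg dG HL mu0 Gm).
- exact: (graph_deriv_le yg dG HL mu0 Gm).
Qed.

End PenaltyHessian.

(** * Signs of the Lipschitz constants *)

Section NonnegativeConstants.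
Context (R : realType) (n : nat).
Hypothesis n0 : (0 < n)%N.
Implicit Type h : 'rV[R]_n -> R.

(** Testing a Lipschitz inequality at such a vector and at 0 shows that its constant is nonnegative;
    in dimension 0 any constant would satisfy it. *)
Lemma exists_unit_vector : exists e : 'rV[R]_n, enorm e = 1.
Proof.
exists (delta_mx 0 (Ordinal n0)); rewrite enormE /dot -rowE !mxE eqxx.
by rewrite sqrtr1.
Qed.

Lemma lipschitz_const_ge0 C h : lipschitz_const C h -> 0 <= C.
Proof.
have [e e1] := exists_unit_vector; move=> /(_ e 0); rewrite subr0 e1 mulr1.
exact: le_trans.
Qed.

Lemma lipschitz_gradient_ge0 C h : lipschitz_gradient C h -> 0 <= C.
Proof.
have [e e1] := exists_unit_vector; move=> /(_ e 0); rewrite subr0 e1 mulr1.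
exact: le_trans (enorm_ge0 _).
Qed.

Lemma lipschitz_hessian_ge0 C h : lipschitz_hessian C h -> 0 <= C.
Proof.
have [e e1] := exists_unit_vector; move=> /(_ e 0); rewrite subr0 e1 mulr1.
by move=> /(enorm_mulmx_opnorm e); rewrite e1 mulr1; exact: le_trans (enorm_ge0 _).
Qed.

Lemma lipschitz_third_derivative_ge0 C h : lipschitz_third_derivative C h -> 0 <= C.
Proof.
have [e e1] := exists_unit_vector; move=> /(_ e 0); rewrite subr0 e1 mulr1.
move=> /(trilin_opnorm3 e e e); rewrite e1 !mulr1.
exact: le_trans (normr_ge0 _).
Qed.

End NonnegativeConstants.

(** * Partial functions in y and their minimizers *)

Section Slices.
Context (R : realType) (dx dy : nat).

Lemma is_diff_slice (h : 'rV[R]_dx -> 'rV[R]_dy -> R) (Gh : _ -> 'rV[R]_(dx + dy)) x p :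
  (forall z, is_diff z (joint h) (dot (Gh z))) ->
  is_diff p (h x) (dot (rsubmx (Gh (row_mx x p)))).
Proof.
move=> dh.
have dr : is_diff p (fun q : 'rV[R]_dy => row_mx x q)
    (fun v => v *m (row_mx 0 1%:M : 'M[R]_(dy, dx + dy))).
  apply: eps_is_diff => e e0; exists 1 => // q _.
  rewrite mul_mx_row mulmx0 mulmx1 !(opp_row_mx, add_row_mx) !subrr row_mx0 enorm0.
  by rewrite mulr_ge0 ?enorm_ge0 // ltW.
have := is_diff_comp dr (dh (row_mx x p)).
rewrite (_ : joint h \o _ = h x); last first.
  by apply/funext => q; rewrite /joint /= row_mxKl row_mxKr.
rewrite (_ : dot (Gh (row_mx x p)) \o _ = dot (rsubmx (Gh (row_mx x p)))) //.
by apply/funext => v /=; rewrite mul_mx_row mulmx0 mulmx1 dot_row_mx0l.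
Qed.

Lemma ystar_critical (h : 'rV[R]_dx -> 'rV[R]_dy -> R) (Gh : _ -> 'rV[R]_(dx + dy)) m x :
  0 < m -> (forall z, is_diff z (joint h) (dot (Gh z))) ->
  (forall x p q, m * enorm (p - q) ^+ 2 <=
    dot (rsubmx (Gh (row_mx x p)) - rsubmx (Gh (row_mx x q))) (p - q)) ->
  rsubmx (Gh (row_mx x (ystar h x))) = 0.
Proof.
move=> m0 dh hm; have ds p := is_diff_slice x p dh.
rewrite -(is_diff_gradient (ds _)); apply: (@gradient_argmin _ _ _ m) => //.
by move=> p q; rewrite !(is_diff_gradient (ds _)).
Qed.

(** Removes from the Lagrangian the term in [gstar], which does not depend on y. *)
Lemma argminD_cst (h : 'rV[R]_dy -> R) c : argmin (fun y => h y + c) = argmin h.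
Proof.
rewrite /argmin; congr xget; apply/seteqP.
by split=> y /= ymin y'; have := ymin y'; rewrite lerD2r.
Qed.

End Slices.

(** [K] precedes all data, dimensions included, as an absolute constant must. Positivity of [lambda]
    is separate because [L_f] may be 0. Twice differentiability is part of the conclusion, so that
    the Hessians are genuine derivatives. *)
Theorem lemmaC3 (R : realType) :
  exists K : R,
  forall (dx dy : nat) (f g : 'rV[R]_dx -> 'rV[R]_dy -> R)
    (mu C_f L_f L_g rho_f rho_g nu_g : R),
  (0 < dy)%N ->
  (forall x, strongly_convex mu (g x)) ->
  thrice_differentiable (joint g) ->
  lipschitz_gradient L_g (joint g) ->
  lipschitz_hessian rho_g (joint g) ->
  lipschitz_third_derivative nu_g (joint g) ->
  (forall x, lipschitz_const C_f (f x)) ->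
  C3 (joint f) ->
  lipschitz_gradient L_f (joint f) ->
  lipschitz_hessian rho_f (joint f) ->
  has_lbound (range (phi f g)) ->
  let ell := Num.max C_f (Num.max L_f (Num.max L_g
               (Num.max rho_g (Num.max rho_f nu_g)))) in
  let kappa := ell / mu in
  let D2 := (1 / mu + 2 * L_g / mu ^+ 2) * (L_f + C_f * rho_g / mu) in
  let D6 := 2 * L_g * D2 ^+ 2 +
            (1 + L_g / mu) ^+ 2 *
              (C_f * rho_f / mu + C_f * L_f * rho_g / mu ^+ 2 +
               C_f ^+ 2 * nu_g / (2 * mu ^+ 2) +
               C_f ^+ 2 * rho_g ^+ 2 / (2 * mu ^+ 3)) in
  D6 <= K * (ell * kappa ^+ 6) /\
  twice_differentiable (phi f g) /\
  forall lambda : R, 0 < lambda -> 2 * L_f / mu <= lambda ->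
    twice_differentiable (lagrangian_star f g lambda) /\
    forall x : 'rV[R]_dx,
      opnorm (hessian (lagrangian_star f g lambda) x - hessian (phi f g) x)
        <= D6 / lambda.
Proof.
exists 84 => dx dy f g mu C_f L_f L_g rho_f rho_g nu_g dy0 gconv g3 gL gH gT fC [f3 _] fL fH _.
have [mu0 _] := gconv 0.
have dxy : (0 < dx + dy)%N by rewrite addn_gt0 dy0 orbT.
have L_f0 := lipschitz_gradient_ge0 dxy fL.
have rho_f0 := lipschitz_hessian_ge0 dxy fH.
have rho_g0 := lipschitz_hessian_ge0 dxy gH.
have nu_g0 := lipschitz_third_derivative_ge0 dxy gT.
have C_f0 := lipschitz_const_ge0 dy0 (fC 0).
have [f2 _] := f3; have [g2 _] := g3.
have df p : is_diff p (joint f) (dot (gradient (joint f) p)) by apply: gradientE; exact: f2.1.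
have dg p : is_diff p (joint g) (dot (gradient (joint g) p)) by apply: gradientE; exact: g2.1.
have dF p : is_diff p (gradient (joint f)) (fun v => v *m hessian (joint f) p).
  by apply: jacobianE; exact: f2.2.
have dG p : is_diff p (gradient (joint g)) (fun v => v *m hessian (joint g) p).
  by apply: jacobianE; exact: g2.2.
have dH p := is_diff_third p g3.
have Hsym p u v := hessian_sym p u v g2.
have Tsym p u v w := third_sym p u v w g3.
have Tlin p a u v := third_linear (joint g) p a u v.
have KL p u v := hessian_norm_le p u v f2 fL.
have Klip p q u v := hessian_lip p q u v fH.
have HL p u v := hessian_norm_le p u v g2 gL.
have Hlip p q u v := hessian_lip p q u v gH.
have Gtaylor p q v := gradient_taylor p q v g2 gH.
have TL p u v w := third_norm_le p u v w g3 gH.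
have Htaylor p q u v := hessian_taylor p q u v g3 gT.
have Gm x p q : mu * enorm (p - q) ^+ 2 <=
    dot (rsubmx (gradient (joint g) (row_mx x p)) - rsubmx (gradient (joint g) (row_mx x q)))
      (p - q).
  have ds y := is_diff_slice x y dg.
  rewrite -!(is_diff_gradient (ds _)); exact: strongly_convex_monotone.
have FC p v : `|dot (rsubmx (gradient (joint f) p)) v| <= C_f * enorm v.
  have := is_diff_slice (lsubmx p) (rsubmx p) df; rewrite hsubmxK => ds.
  have := @is_diff_path _ _ _ _ _ (rsubmx p) v 0; rewrite scale0r addr0.
  move=> /(_ _ _ _ ds)/is_derive_norm_le; apply => t /andP[t0 _].
  apply: le_trans (fC _ _ _) _.
  by rewrite scale0r addr0 addrAC subrr add0r enormZ gtr0_norm // mulrA mulrAC.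
(* Coercivity and the bound on the Hessian of [g], compared on a unit vector in the y-directions. *)
have muL : mu <= L_g.
  have [e e1] := exists_unit_vector R dy0.
  have := hessian_coercive dG Gm 0 0 e; rewrite e1 expr1n mulr1 => /le_trans; apply.
  apply: le_trans (ler_norm _) _; apply: le_trans (HL _ _ _) _.
  by rewrite !enorm_row_mx0l e1 !mulr1.
have yg0 x := ystar_critical x mu0 dg Gm.
have phiE : phi f g = joint f \o graph_pt (ystar g).
  by apply/funext => x; rewrite /phi /joint /= row_mxKl row_mxKr.
move=> ell kappa D2 D6; split.
  by apply: D6_const_le => //; rewrite /ell !le_max lexx ?orbT.
split.
  rewrite phiE.
  exact: (twice_differentiable_phi df dF dG dH Hsym fL gL HL Hlip Gm mu0 muL L_f0 rho_g0 yg0).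
move=> lambda lambda0 lambdaL.
(* The Lagrangian without its term constant in y; it has the same minimizers. *)
pose k x y := f x y + lambda * g x y.
have dk z : is_diff z (joint k)
    (dot (penalty_grad (gradient (joint f)) (gradient (joint g)) lambda z)).
  rewrite (_ : joint k = penalty (joint f) (joint g) lambda) //.
  exact: (is_diff_penalty lambda df dg z).
have lE x : ystar (lagrangian f g lambda) x = ystar k x.
  rewrite /ystar -(argminD_cst (k x) (- (lambda * gstar g x))); congr argmin.
  by apply/funext => y; rewrite /lagrangian /k mulrBr addrA.
have km := penalty_grad_monotone fL Gm mu0 lambda0 lambdaL.
have m0 : 0 < lambda * mu / 2 by rewrite divr_gt0 // mulr_gt0.
have yl0 x := ystar_critical x m0 dk km.
have LE : lagrangian_star f g lambda =
    penalty_value (joint f) (joint g) lambda (ystar g) (ystar k).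
  apply/funext => x; rewrite /lagrangian_star /penalty_value /penalty /lagrangian lE.
  by rewrite /gstar /graph_pt /joint !row_mxKl !row_mxKr mulrBr addrA.
rewrite LE phiE; split.
  exact: (twice_differentiable_penalty_value df dg dF dG fL gL Gm mu0 yg0 lambda0 lambdaL yl0).
exact: (penalty_hessian_gap df dg dF dG dH Hsym Tsym Tlin FC fL KL Klip gL HL Hlip Gtaylor
  TL Htaylor Gm mu0 muL L_f0 C_f0 rho_f0 rho_g0 nu_g0 yg0 lambda0 lambdaL yl0).
Qed.
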